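(* There is a universal constant $C>0$ such that (i) holds, and (ii) holds. (i) Let $u$ be an $\infty$-harmonic function in a domain $\Omega\subset\mathbb{R}^2$. Then $$|Du(x)|\le \frac{C}{r}\,⨍_{B(x,r)}|u|\,dy\quad\text{whenever } B(x,r)\subset\Omega,$$ where $⨍_{B(x,r)}|u|\,dy=\frac{1}{|B(x,r)|}\int_{B(x,r)}|u|\,dy$, and hence $$\|Du\|_{L^\infty(B(x,r))}\le \frac{C}{r^{3}}\|u\|_{L^1(B(x,2r))}\quad\text{whenever } B(x,2r)\subset\Omega.$$ (ii) Let $u$ be an $\infty$-harmonic function in $\mathbb{R}^2$ with $$\liminf_{R\to\infty}\ \inf_{c\in\mathbb{R}}\ \frac1R\,\frac{1}{|B(0,R)|}\int_{B(0,R)}|u(x)-c|\,dx<\infty .$$ Then there is a vector $a\in\mathbb{R}^2$ such that $u(x)=u(0)+a\cdot x$ for all $x\in\mathbb{R}^2$.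
   Context: A domain is a connected open set. A function $u\in C^0(\Omega)$ is $\infty$-harmonic in $\Omega$ if it is a viscosity solution of $\Delta_\infty u:=D^2u\,Du\cdot Du=0$ in $\Omega$ (i.e. whenever $\varphi\in C^2$ and $u-\varphi$ has a local maximum, resp. minimum, at $x\in\Omega$, one has $\Delta_\infty\varphi(x)\ge0$, resp. $\le 0$). It is known that $\infty$-harmonic functions are locally Lipschitz and everywhere differentiable, so $Du(x)$ makes sense at every point. $B(x,r)$ is the open ball of center $x$ and radius $r$. *)

(* Defs.v *)
From HB Require Import structures.
From mathcomp Require Import all_boot all_order all_algebra.
From mathcomp Require Import all_classical all_reals all_analysis.

Set Implicit Arguments.
Unset Strict Implicit.
Unset Printing Implicit Defensive.

Import Order.TTheory GRing.Theory Num.Theory.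
Import numFieldNormedType.Exports.

Local Open Scope classical_set_scope.
Local Open Scope ring_scope.

Section Plane.
Context {R : realType}.

(* The norm and the metric that the library puts on [R * R] are the max ones;
   the Euclidean norm and ball are therefore defined here (the topology is the
   same). *)
Definition dot (v w : R * R) : R := v.1 * w.1 + v.2 * w.2.
Definition enorm (v : R * R) : R := Num.sqrt (dot v v).
Definition eball (x : R * R) (r : R) : set (R * R) :=
  [set y | enorm (y - x) < r].

Definition domain (Omega : set (R * R)) := open Omega /\ connected Omega.

Definition lebesgue2 :
    {measure set (measurableTypeR R * measurableTypeR R) -> \bar R} :=
  (@lebesgue_measure R \x @lebesgue_measure R)%E.

Definition avg (A : set (R * R)) (f : R * R -> R) : \bar R :=
  ((fine (lebesgue2 A))^-1%:E * \int[lebesgue2]_(y in A) (f y)%:E)%E.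

(* Norms in L^p(A), computed as norms over the plane of the extension by 0. *)
Definition LnormOn (p : \bar R) (A : set (R * R)) (f : R * R -> R) : \bar R :=
  Lnorm lebesgue2 p ((EFin \o f) \_ A).

Definition d1 (f : R * R -> R) (x : R * R) : R := 'D_(1, 0) f x.
Definition d2 (f : R * R -> R) (x : R * R) : R := 'D_(0, 1) f x.

Definition grad (f : R * R -> R) (x : R * R) : R * R := (d1 f x, d2 f x).

Definition hess_app (f : R * R -> R) (x v : R * R) : R * R :=
  (d1 (d1 f) x * v.1 + d2 (d1 f) x * v.2,
   d1 (d2 f) x * v.1 + d2 (d2 f) x * v.2).

Definition inf_laplacian (f : R * R -> R) (x : R * R) : R :=
  dot (hess_app f x (grad f x)) (grad f x).

Definition C0 (A : set (R * R)) (f : R * R -> R) := {within A, continuous f}.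

Definition C1 (A : set (R * R)) (f : R * R -> R) :=
  [/\ C0 A f,
      forall x, A x -> derivable f x (1, 0) /\ derivable f x (0, 1),
      C0 A (d1 f) & C0 A (d2 f)].

Definition C2 (A : set (R * R)) (f : R * R -> R) :=
  [/\ C1 A f, C1 A (d1 f) & C1 A (d2 f)].

Definition local_max (f : R * R -> R) (x : R * R) :=
  \forall y \near x, f y <= f x.
Definition local_min (f : R * R -> R) (x : R * R) :=
  \forall y \near x, f x <= f y.

(* Functions on [Omega] are represented by total functions, whose values
   outside the open set [Omega] are irrelevant. *)
Definition inf_harmonic (Omega : set (R * R)) (u : R * R -> R) :=
  C0 Omega u /\
  forall (phi : R * R -> R) (x : R * R), C2 Omega phi -> Omega x ->
    (local_max (fun y => u y - phi y) x -> 0 <= inf_laplacian phi x) /\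
    (local_min (fun y => u y - phi y) x -> inf_laplacian phi x <= 0).

End Plane.

(* Main.v *)
(* A subharmonic function (in the viscosity sense) satisfies comparison with
   cones, tested here with quadratic polynomials only. Hence |u| <= M on a ball
   of radius r gives a Lipschitz bound C M / r on the concentric half ball, and
   applying this at the maximum of the weighted function (r - |y|)^2 |u y|
   replaces sup |u| by the average of |u|. This yields (i) and reduces (ii) to a
   function u on the plane with best Lipschitz constant L > 0.

   By comparison with cones from a fixed vertex, u is within eps r of a plane of
   slope e, |e| = L, on arbitrarily large balls of radius r. Let l be an affine
   function with slope f. If f . (e - f) <> 0, then {u > l} is connected: a
   second component would lie in a thin strip not parallel to f, and there the
   cone of slope |f| with vertex on l straight behind a point of the component
   bounds u by l. On the other hand, if u is not affine on a nonvertical line,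
   then for some slope k along the line and three points a, m, b of it, u > l at
   a and b and u < l at m for all l with slope k along the line, and turning l
   about the line moves the path joining a to b in {u > l} from one side of m to
   the other, so that {u > l} is disconnected for some such l (both sides at once
   would contradict the minimum principle near m). Using first slopes k for which
   f cannot lie on the circle f . (e - f) = 0, this confines the increments of u
   to the disc bounded by the circle; then u - l is monotone in a fixed direction
   for f <> e on the circle, so {u > l} is connected there too, and u must be
   affine with slope e. *)

From HB Require Import structures.
Require Import Defs.
From mathcomp Require Import all_boot all_order all_algebra.
From mathcomp Require Import all_classical all_reals all_analysis.
From mathcomp Require Import measurable_realfun ess_sup_inf ring lra.

Set Implicit Arguments.
Unset Strict Implicit.
Unset Printing Implicit Defensive.

Import Order.TTheory GRing.Theory Num.Theory.
Import numFieldNormedType.Exports.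

Local Open Scope classical_set_scope.
Local Open Scope ring_scope.

(** * Euclidean plane *)

Section Euclid.
Context {R : realType}.
Implicit Types (x y z v w : R * R) (r e : R).

Lemma enorm_ge0 v : 0 <= enorm v.
Proof. exact: sqrtr_ge0. Qed.

Lemma dot_ge0 v : 0 <= dot v v.
Proof. by rewrite /dot addr_ge0 // -expr2 sqr_ge0. Qed.

Lemma enorm_sqr v : enorm v ^+ 2 = dot v v.
Proof. by rewrite sqr_sqrtr // dot_ge0. Qed.

Lemma enorm_le v r : 0 <= r -> (enorm v <= r) = (dot v v <= r ^+ 2).
Proof.
move=> r0; rewrite -enorm_sqr.
by rewrite ler_pXn2r ?nnegrE ?enorm_ge0.
Qed.

Lemma enorm_lt v r : 0 <= r -> (enorm v < r) = (dot v v < r ^+ 2).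
Proof.
move=> r0; rewrite -enorm_sqr.
by rewrite ltr_pXn2r ?nnegrE ?enorm_ge0.
Qed.

Lemma dot_le_enorm v w : dot v w <= enorm v * enorm w.
Proof.
have h : dot v w ^+ 2 <= (enorm v * enorm w) ^+ 2.
  rewrite exprMn !enorm_sqr /dot.
  have := sqr_ge0 (v.1 * w.2 - v.2 * w.1); nra.
have h0 : 0 <= enorm v * enorm w by rewrite mulr_ge0 // enorm_ge0.
have [d0|d0] := leP 0 (dot v w); last by apply: le_trans h0; exact: ltW.
by move: h; rewrite ler_pXn2r.
Qed.

Lemma enormN v : enorm (- v) = enorm v.
Proof. by rewrite /enorm /dot /= !mulrNN. Qed.

Lemma enormC x y : enorm (x - y) = enorm (y - x).
Proof. by rewrite -enormN opprB. Qed.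

Lemma dotNl v w : dot (- v) w = - dot v w.
Proof. by rewrite /dot /=; ring. Qed.

Lemma enormD v w : enorm (v + w) <= enorm v + enorm w.
Proof.
rewrite enorm_le ?addr_ge0 ?enorm_ge0 //.
have -> : dot (v + w) (v + w) = dot v v + 2 * dot v w + dot w w.
  by rewrite /dot /=; ring.
rewrite -!enorm_sqr; have := dot_le_enorm v w; nra.
Qed.

Lemma enorm_triangle z x y : enorm (x - y) <= enorm (x - z) + enorm (z - y).
Proof. by rewrite -[x - y](subrKA z); exact: enormD. Qed.

Lemma enorm0 : enorm (0 : R * R) = 0.
Proof. by rewrite /enorm /dot /= !mulr0 addr0 sqrtr0. Qed.

Lemma enormZ a v : enorm (a *: v) = `|a| * enorm v.
Proof.
rewrite /enorm.
have -> : dot (a *: v) (a *: v) = a ^+ 2 * dot v v by rewrite /dot /= /GRing.scale /=; ring.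
by rewrite sqrtrM ?sqr_ge0 // sqrtr_sqr.
Qed.

Lemma enorm_eq0 v : enorm v = 0 -> v = 0.
Proof.
move=> h; have := enorm_sqr v; rewrite h expr0n /= /dot => /esym.
case: v h => a b /= _ h; have := sqr_ge0 a; have := sqr_ge0 b => hb ha.
have a0 : a ^+ 2 = 0 by nra.
have b0 : b ^+ 2 = 0 by nra.
by move/eqP: a0; rewrite sqrf_eq0 => /eqP ->; move/eqP: b0; rewrite sqrf_eq0 => /eqP ->.
Qed.

Lemma enorm_gt0 v : v != 0 -> 0 < enorm v.
Proof.
move=> v0; rewrite lt_neqAle enorm_ge0 andbT eq_sym.
by apply: contraNneq v0 => /enorm_eq0 ->.
Qed.

Lemma normr1_enorm v : `|v.1| <= enorm v.
Proof.
rewrite -sqrtr_sqr ler_sqrt ?dot_ge0 // /dot; have := sqr_ge0 v.2; nra.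
Qed.

Lemma normr2_enorm v : `|v.2| <= enorm v.
Proof.
rewrite -sqrtr_sqr ler_sqrt ?dot_ge0 // /dot; have := sqr_ge0 v.1; nra.
Qed.

Lemma enorm_le_add v : enorm v <= `|v.1| + `|v.2|.
Proof.
rewrite enorm_le ?addr_ge0 // /dot.
have := normr_ge0 v.1; have := normr_ge0 v.2.
have := real_normK (num_real v.1); have := real_normK (num_real v.2); nra.
Qed.

Lemma nbhs_boxP x (A : set (R * R)) :
  nbhs x A <-> exists2 e, 0 < e & forall y, `|y.1 - x.1| < e -> `|y.2 - x.2| < e -> A y.
Proof.
split=> [/nbhs_ballP[e /= e0 h]|[e e0 h]].
  exists e => // y h1 h2; apply: h; split; rewrite /ball /= distrC //.
by apply/nbhs_ballP; exists e => // y [h1 h2]; apply: h; rewrite distrC.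
Qed.

Lemma nbhs_eball x (A : set (R * R)) :
  nbhs x A <-> exists2 e, 0 < e & eball x e `<=` A.
Proof.
rewrite nbhs_boxP; split=> -[e e0 h].
  exists e => // y; rewrite /eball /= => hy; apply: h.
    exact: le_lt_trans (normr1_enorm (y - x)) hy.
  exact: le_lt_trans (normr2_enorm (y - x)) hy.
exists (e / 2); first by rewrite divr_gt0.
move=> y h1 h2; apply: h; rewrite /eball /=.
apply: le_lt_trans (enorm_le_add _) _.
rewrite /=; lra.
Qed.

Lemma enorm_continuous z : continuous (fun y => enorm (y - z)).
Proof.
move=> x; apply/cvgrPdist_lt => e e0; apply/nbhs_eball.
exists e => // y; rewrite /eball /= => hy.
apply: le_lt_trans hy; rewrite ler_norml.
have := enorm_triangle y x z; have := enorm_triangle x y z.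
by rewrite (enormC x y) => ? ?; apply/andP; split; lra.
Qed.

Lemma dot_continuous v : continuous (dot v).
Proof.
move=> x; rewrite /dot; apply: cvgD; (apply: cvgM; first exact: cvg_cst).
  exact: cvg_fst.
exact: cvg_snd.
Qed.

Lemma box_compact (c : R) :
  compact [set y : R * R | -c <= y.1 <= c /\ -c <= y.2 <= c].
Proof.
have -> : [set y : R * R | -c <= y.1 <= c /\ -c <= y.2 <= c] =
    `[-c, c]%classic `*` `[-c, c]%classic.
  by apply/seteqP; split=> y /=; rewrite !in_itv.
by apply: compact_setX; exact: segment_compact.
Qed.

Arguments box_compact : clear implicits.

Lemma closed_bounded_compact (K : set (R * R)) (c : R) :
  closed K -> (forall y, K y -> `|y.1| <= c /\ `|y.2| <= c) -> compact K.
Proof.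
move=> Kc Kb; apply: (subclosed_compact Kc (box_compact c)) => y /Kb /=.
by rewrite !ler_norml.
Qed.

Lemma cball_closed x r : closed [set y | enorm (y - x) <= r].
Proof.
have -> : [set y | enorm (y - x) <= r] = (fun y => enorm (y - x)) @^-1` [set t | t <= r] by [].
by apply: closed_comp => [y _|]; [exact: enorm_continuous|exact: closed_le].
Qed.

Lemma cball_compact x r : compact [set y | enorm (y - x) <= r].
Proof.
apply: (@closed_bounded_compact _ (enorm x + r)); first exact: cball_closed.
move=> y /= h; have hy : enorm y <= enorm x + r.
  by have := enorm_triangle x y 0; rewrite !subr0; lra.
by split; apply: le_trans hy; [exact: normr1_enorm|exact: normr2_enorm].
Qed.

Lemma compact_enorm_bounded (K : set (R * R)) z :
  compact K -> exists2 B, 0 < B & forall y, K y -> enorm (y - z) < B.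
Proof.
move=> Kc; have [K0|K0] := pselect (K !=set0); last first.
  by exists 1 => // y Ky; exfalso; apply: K0; exists y.
have [] := @compact_EVT_max _ R (fun y => enorm (y - z)) K K0 Kc.
  by apply: continuous_subspaceT; exact: enorm_continuous.
move=> c _ hc; exists (enorm (c - z) + 1).
  by rewrite ltr_wpDl // enorm_ge0.
by move=> y Ky; have := hc y (mem_set Ky); lra.
Qed.

End Euclid.

Arguments cball_compact {R} x r.

(** * Viscosity solutions and quadratic test functions *)

Section Jets.
Context {R : realType}.
Implicit Types (x y z p : R * R) (a b c : R) (u : R * R -> R) (Om K : set (R * R)).

(** The quadratic Taylor polynomial without constant term, with gradient [p] and Hessian entries
    [a], [b], [c]. *)
Definition jet p a b c (h : R * R) : R :=
  dot p h + (a * h.1 ^+ 2 + 2 * b * h.1 * h.2 + c * h.2 ^+ 2) / 2.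

(** Viscosity subsolutions, tested with quadratics touching from above; the conclusion is the sign
    of the infinity Laplacian of the [jet] at its centre. *)
Definition subharmonic Om u :=
  C0 Om u /\ forall x p a b c, Om x ->
    (\forall y \near x, u y <= u x + jet p a b c (y - x)) ->
    0 <= a * p.1 ^+ 2 + 2 * b * p.1 * p.2 + c * p.2 ^+ 2.

Lemma is_derive_quadratic (f : R * R -> R) x v d e :
  (forall h, f (h *: v + x) - f x = h * d + h ^+ 2 * e) -> is_derive x v f d.
Proof.
move=> hf.
have hc : (fun h : R => h^-1 *: (f (h *: v + x) - f x)) @ 0^' --> d.
  apply: (@cvg_trans _ ((fun h : R => d + h * e) @ 0^')).
    apply: near_eq_cvg; near=> h.
    have h0 : h != 0 by near: h; exact: nbhs_dnbhs_neq.
    by rewrite hf /GRing.scale /= mulrDr mulrA mulVf // mul1r expr2 !mulrA mulVf // mul1r.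
  have -> : d = d + 0 * e by rewrite mul0r addr0.
  apply: cvgD; first by rewrite mul0r addr0; exact: cvg_cst.
  apply: cvgMl; apply: cvg_within_filter; exact: cvg_id.
apply: DeriveDef; first by apply/cvg_ex; exists d.
exact: cvg_lim hc.
Unshelve. all: by end_near. Qed.

Definition affine (k l1 l2 : R) : R * R -> R := fun x => k + l1 * x.1 + l2 * x.2.

Lemma continuous_affine k l1 l2 : continuous (affine k l1 l2).
Proof.
move=> x; apply: cvgD; first apply: cvgD; first exact: cvg_cst.
  by apply: cvgMr; exact: cvg_fst.
by apply: cvgMr; exact: cvg_snd.
Qed.

Lemma d1_affine k l1 l2 : d1 (affine k l1 l2) = affine l1 0 0.
Proof.
apply/funext => x; rewrite /d1; apply: derive_val.
by apply: (@is_derive_quadratic _ _ _ _ 0) => h; rewrite /affine /= /GRing.scale /=; ring.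
Qed.

Lemma d2_affine k l1 l2 : d2 (affine k l1 l2) = affine l2 0 0.
Proof.
apply/funext => x; rewrite /d2; apply: derive_val.
by apply: (@is_derive_quadratic _ _ _ _ 0) => h; rewrite /affine /= /GRing.scale /=; ring.
Qed.

Lemma C1_affine Om k l1 l2 : C1 Om (affine k l1 l2).
Proof.
split; rewrite ?d1_affine ?d2_affine;
  try by apply: continuous_subspaceT; exact: continuous_affine.
move=> x _; split; apply: ex_derive; apply: is_derive_quadratic => h;
  rewrite /affine /= /GRing.scale /=;
  [instantiate (1 := 0); instantiate (1 := l1)|instantiate (1 := 0); instantiate (1 := l2)]; ring.
Qed.

Definition jet_at x k p a b c : R * R -> R := fun y => k + jet p a b c (y - x).

Lemma is_derive1_jet x k p a b c y :
  is_derive y (1, 0) (jet_at x k p a b c) (affine (p.1 - a * x.1 - b * x.2) a b y).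
Proof.
apply: (@is_derive_quadratic _ _ _ _ (a / 2)) => h.
by rewrite /jet_at /jet /dot /affine /= /GRing.scale /=; field.
Qed.

Lemma is_derive2_jet x k p a b c y :
  is_derive y (0, 1) (jet_at x k p a b c) (affine (p.2 - b * x.1 - c * x.2) b c y).
Proof.
apply: (@is_derive_quadratic _ _ _ _ (c / 2)) => h.
by rewrite /jet_at /jet /dot /affine /= /GRing.scale /=; field.
Qed.

Lemma d1_jet x k p a b c :
  d1 (jet_at x k p a b c) = affine (p.1 - a * x.1 - b * x.2) a b.
Proof. by apply/funext => y; rewrite /d1; apply: derive_val; exact: is_derive1_jet. Qed.

Lemma d2_jet x k p a b c :
  d2 (jet_at x k p a b c) = affine (p.2 - b * x.1 - c * x.2) b c.
Proof. by apply/funext => y; rewrite /d2; apply: derive_val; exact: is_derive2_jet. Qed.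

Lemma C2_jet Om x k p a b c : C2 Om (jet_at x k p a b c).
Proof.
split; rewrite ?d1_jet ?d2_jet; try exact: C1_affine.
split; rewrite ?d1_jet ?d2_jet;
  try by apply: continuous_subspaceT; exact: continuous_affine.
  apply: continuous_subspaceT => y; rewrite /jet_at /jet /dot.
  have h1 : (fun y0 : R * R => (y0 - x).1) @ y --> (y - x).1.
    by apply: cvgB; [exact: cvg_fst|exact: cvg_cst].
  have h2 : (fun y0 : R * R => (y0 - x).2) @ y --> (y - x).2.
    by apply: cvgB; [exact: cvg_snd|exact: cvg_cst].
  apply: cvgD; first exact: cvg_cst.
  apply: cvgD.
    by apply: cvgD; (apply: cvgM; first exact: cvg_cst).
  apply: cvgM; last exact: cvg_cst.
  apply: cvgD; last by apply: cvgM; [exact: cvg_cst|exact: (cvgM h2 h2)].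
  apply: cvgD; first by apply: cvgM; [exact: cvg_cst|exact: (cvgM h1 h1)].
  by apply: cvgM => //; apply: cvgM => //; exact: cvg_cst.
move=> y _; split; apply: ex_derive.
  exact: is_derive1_jet.
exact: is_derive2_jet.
Qed.

Lemma inf_laplacian_jet x k p a b c :
  inf_laplacian (jet_at x k p a b c) x = a * p.1 ^+ 2 + 2 * b * p.1 * p.2 + c * p.2 ^+ 2.
Proof.
by rewrite /inf_laplacian /hess_app /grad d1_jet d2_jet !d1_affine !d2_affine /dot /affine /=; ring.
Qed.

Lemma inf_harmonic_sub Om u : inf_harmonic Om u -> subharmonic Om u.
Proof.
move=> [uC uh]; split => // x p a b c Ox hx.
have [h _] := uh _ x (C2_jet Om x (u x) p a b c) Ox.
rewrite -(inf_laplacian_jet x (u x)); apply: h.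
rewrite /local_max; apply: filterS hx => y hy.
by rewrite /jet_at /jet /dot !subrr /= in hy *; lra.
Qed.

Lemma inf_harmonic_subN Om u : inf_harmonic Om u -> subharmonic Om (fun y => - u y).
Proof.
move=> [uC uh]; split.
  by move=> x; apply: cvgN; exact: uC.
move=> x p a b c Ox hx.
have [_ h] := uh _ x (C2_jet Om x (u x) (- p) (- a) (- b) (- c)) Ox.
suff : inf_laplacian (jet_at x (u x) (- p) (- a) (- b) (- c)) x <= 0.
  by rewrite inf_laplacian_jet /=; lra.
apply: h; rewrite /local_min; apply: filterS hx => y.
by rewrite /jet_at /jet /dot !subrr /=; lra.
Qed.

End Jets.

(** * Comparison with cones and planes *)

Section Comparison.
Context {R : realType}.
Implicit Types (x y z p f v : R * R) (u psi : R * R -> R) (Om K : set (R * R)).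

Lemma pair_scale1 (k : R) v : (k *: v).1 = k * v.1. Proof. by []. Qed.

Lemma pair_scale2 (k : R) v : (k *: v).2 = k * v.2. Proof. by []. Qed.

(** Points with [~ nbhs x K] are the boundary points of [K]. A maximum of [u - psi] above its
    boundary bound [B] is interior, so a translate of [psi] touches [u] from above there. *)
Lemma max_touch Om K u psi x1 (B : R) :
  C0 Om u -> compact K -> K `<=` Om -> continuous psi -> K x1 ->
  B < u x1 - psi x1 ->
  (forall x, K x -> ~ nbhs x K -> u x - psi x <= B) ->
  exists xh, [/\ K xh, B < u xh - psi xh &
    \forall y \near xh, u y <= u xh + (psi y - psi xh)].
Proof.
move=> uC Kc KO psiC Kx1 Bx1 hB.
have [||xh] := @compact_EVT_max _ R (fun x => u x - psi x) K _ Kc.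
- by exists x1.
- move=> x; apply: cvgB; first exact: (continuous_subspaceW KO uC).
  exact: (continuous_subspaceT psiC).
rewrite inE => Kxh hmax; exists xh; have Bxh : B < u xh - psi xh.
  by apply: lt_le_trans Bx1 _; apply: hmax; rewrite inE.
split => //.
have [nK|nK] := pselect (nbhs xh K); last first.
  by have := hB xh Kxh nK; rewrite leNgt Bxh.
apply: filterS nK => y Ky; have := hmax y (mem_set Ky); lra.
Qed.

(* Since |x| is touched from above, at distance r of the vertex, by an affine
   function plus b^2/r in the coordinate b orthogonal to the axis, subtracting
   a small multiple of |x|^2 turns the cone into a strict supersolution. *)
Lemma cone_above_jet (z xh : R * R) : xh != z ->
  let r := enorm (xh - z) in let w := xh - z in
  \forall y \near xh, enorm (y - z) <=
    r + dot w (y - xh) / r + (w.1 * (y - xh).2 - w.2 * (y - xh).1) ^+ 2 / r ^+ 3.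
Proof.
move=> xz r w; have r0 : 0 < r by rewrite enorm_gt0 // subr_eq0.
have wr : w.1 ^+ 2 + w.2 ^+ 2 = r ^+ 2 by rewrite enorm_sqr /dot !expr2.
apply/nbhs_eball; exists (r / 2); first by rewrite divr_gt0.
move=> y; rewrite /eball /=; set h := y - xh => hr.
have -> : y - z = w + h by rewrite /w /h [RHS]addrC subrKA.
set al := dot w h / r; set b := (w.1 * h.2 - w.2 * h.1) / r.
have hal : - (r / 2) <= al.
  rewrite /al ler_pdivlMr //; have := dot_le_enorm (- w) h; rewrite dotNl enormN -/r; nra.
have hb : (w.1 * h.2 - w.2 * h.1) ^+ 2 / r ^+ 3 = b ^+ 2 / r.
  by rewrite /b; field; lra.
rewrite hb.
have bb : 0 <= b ^+ 2 / r by rewrite divr_ge0 ?sqr_ge0 // ltW.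
have hh : dot h h = al ^+ 2 + b ^+ 2.
  rewrite /al /b /dot; apply: (mulIf (x := r ^+ 2)); first by rewrite expf_neq0 // gt_eqF.
  rewrite -{1}wr; field; lra.
rewrite enorm_le; last by lra.
have -> : dot (w + h) (w + h) = r ^+ 2 + 2 * (al * r) + dot h h.
  by rewrite /al mulfVK ?gt_eqF // -wr /dot /=; ring.
have hq : b ^+ 2 = b ^+ 2 / r * r by rewrite mulfVK ?gt_eqF.
move: bb hq; rewrite hh; set q := b ^+ 2 / r => bb ->.
have : 0 <= q * (r + 2 * al) by apply: mulr_ge0 => //; lra.
have := sqr_ge0 q; nra.
Qed.

(** The vertex counts as a boundary point because the cone is not smooth there. *)
Lemma cone_comparison Om u K z (A s : R) :
  subharmonic Om u -> compact K -> K `<=` Om -> 0 < s ->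
  (forall x, K x -> ~ nbhs x K \/ x = z -> u x <= A + s * enorm (x - z)) ->
  forall x, K x -> u x <= A + s * enorm (x - z).
Proof.
move=> [uC uJ] Kc KO s0 hb x1 Kx1; rewrite leNgt; apply/negP => hx1.
have [B B0 hB] := compact_enorm_bounded z Kc.
set e := u x1 - (A + s * enorm (x1 - z)).
have e0 : 0 < e by rewrite subr_gt0.
(* The first bound keeps the quadratic correction below [e / 2], so the maximum avoids the boundary
   and the vertex; the second keeps the radial slope [s - 2 * dl * r] positive. *)
pose dl := Num.min (e / (2 * B ^+ 2)) (s / (4 * B)).
have dl0 : 0 < dl.
  by rewrite lt_min !divr_gt0 // mulr_gt0 // exprn_gt0.
have dl1 : dl * B ^+ 2 <= e / 2.
  have : dl <= e / (2 * B ^+ 2) by rewrite ge_min lexx.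
  rewrite ler_pdivlMr; last by rewrite mulr_gt0 // exprn_gt0.
  lra.
have dl2 : dl * B <= s / 4.
  have : dl <= s / (4 * B) by rewrite ge_min lexx orbT.
  rewrite ler_pdivlMr; last by rewrite mulr_gt0.
  lra.
pose psi y := A + s * enorm (y - z) - dl * enorm (y - z) ^+ 2.
have psiC : continuous psi.
  move=> y; apply: cvgB; first apply: cvgD; first exact: cvg_cst.
    by apply: cvgMr; exact: enorm_continuous.
  by apply: cvgMr; apply: (cvgM (@enorm_continuous _ z y) (@enorm_continuous _ z y)).
have hK x : K x -> ~ nbhs x K \/ x = z -> u x - psi x <= e / 2.
  move=> Kx hx; have := hb x Kx hx; have := hB x Kx; have := enorm_ge0 (x - z).
  rewrite /psi; set N := enorm _ => N0 NB ?.
  have NB2 : N ^+ 2 <= B ^+ 2 by nra.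
  nra.
have [||xh [Kxh]] := @max_touch Om K u psi x1 (e / 2) uC Kc KO psiC Kx1.
- by have := sqr_ge0 (enorm (x1 - z)); rewrite /psi /e in e0 *; nra.
- by move=> x Kx nK; apply: hK => //; left.
move=> hxh hnear.
have xhz : xh != z.
  by apply/eqP => xz; have := hK xh Kxh (or_intror xz); lra.
have := cone_above_jet xhz; set r := enorm (xh - z); set w := xh - z => /= hcone.
have r0 : 0 < r by rewrite enorm_gt0 // subr_eq0.
have rB : r < B by exact: hB.
have wr : w.1 ^+ 2 + w.2 ^+ 2 = r ^+ 2 by rewrite enorm_sqr /dot !expr2.
have sd : 0 < s - 2 * dl * r by nra.
(* Gradient [k *: w] and Hessian of an upper jet of [psi] at [xh]. The cone's part of the Hessian
   vanishes in the radial direction [w], so only [- 2 * dl] survives. *)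
pose k := s / r - 2 * dl.
pose a := 2 * s * w.2 ^+ 2 / r ^+ 3 - 2 * dl.
pose b := - (2 * s * w.1 * w.2 / r ^+ 3).
pose c := 2 * s * w.1 ^+ 2 / r ^+ 3 - 2 * dl.
have := uJ xh (k *: w) a b c (KO _ Kxh) _.
have -> : a * (k *: w).1 ^+ 2 + 2 * b * (k *: w).1 * (k *: w).2 + c * (k *: w).2 ^+ 2
   = - 2 * dl * (s - 2 * dl * r) ^+ 2.
  have -> : - 2 * dl * (s - 2 * dl * r) ^+ 2 = - 2 * dl * k ^+ 2 * (w.1 ^+ 2 + w.2 ^+ 2).
    by rewrite wr /k; field; lra.
  by rewrite /a /b /c !pair_scale1 !pair_scale2; field; lra.
suff hj : \forall y \near xh, u y <= u xh + jet (k *: w) a b c (y - xh).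
  move=> /(_ hj); rewrite leNgt => /negP; apply.
  by rewrite -mulrA mulNr oppr_lt0 mulr_gt0 // mulr_gt0 // exprn_gt0.
near=> y.
have h1 : u y <= u xh + (psi y - psi xh) by near: y.
have h2 : enorm (y - z) <= r + dot w (y - xh) / r
   + (w.1 * (y - xh).2 - w.2 * (y - xh).1) ^+ 2 / r ^+ 3 by near: y.
apply: le_trans h1 _; rewrite lerD2l /psi -/r.
have -> : enorm (y - z) ^+ 2 = r ^+ 2 + 2 * dot w (y - xh) + dot (y - xh) (y - xh).
  by rewrite enorm_sqr -wr /w /dot /=; ring.
have -> : jet (k *: w) a b c (y - xh) =
  s * (dot w (y - xh) / r + (w.1 * (y - xh).2 - w.2 * (y - xh).1) ^+ 2 / r ^+ 3)
  - dl * (2 * dot w (y - xh) + dot (y - xh) (y - xh)).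
  by rewrite /jet /dot !pair_scale1 !pair_scale2 /k /a /b /c; field; lra.
nra.
Unshelve. all: by end_near. Qed.

(** Cone comparison with a vertex outside [K], letting the slope tend to 0. *)
Lemma const_comparison Om u K (A : R) :
  subharmonic Om u -> compact K -> K `<=` Om ->
  (forall x, K x -> ~ nbhs x K -> u x <= A) ->
  forall x, K x -> u x <= A.
Proof.
move=> uS Kc KO hb x1 Kx1; apply/ler_addgt0Pr => e e0.
have [B B0 hB] := compact_enorm_bounded 0 Kc.
pose z : R * R := (B + 1, 0).
have zK x : K x -> x <> z.
  move=> /hB + xz; rewrite xz subr0 => h; have := le_lt_trans (normr1_enorm _) h.
  by rewrite /= ger0_norm; lra.
have [M M0 hM] := compact_enorm_bounded z Kc.
have s0 : 0 < e / M by rewrite divr_gt0.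
have := @cone_comparison Om u K z A (e / M) uS Kc KO s0 _ x1 Kx1.
have hs : e / M * enorm (x1 - z) <= e.
  by rewrite mulrAC ler_pdivrMr // ler_wpM2l ?ltW // hM.
move=> h; have {}h : u x1 <= A + e / M * enorm (x1 - z).
  apply: h => x Kx [nK|/(zK _ Kx) //].
  apply: le_trans (hb x Kx nK) _; rewrite lerDl mulr_ge0 // ?enorm_ge0 //; lra.
lra.
Qed.

(** With t = [dot f x], replacing t by the concave t - dl t^2 turns the plane into a strict
    supersolution if [f] is nonzero; [f = 0] is the constant case. *)
Lemma plane_comparison Om u K f (A : R) :
  subharmonic Om u -> compact K -> K `<=` Om ->
  (forall x, K x -> ~ nbhs x K -> u x <= A + dot f x) ->
  forall x, K x -> u x <= A + dot f x.
Proof.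
move=> uS Kc KO hb x1 Kx1.
have [f0|f0] := eqVneq f 0.
  have d0 x : dot f x = 0 by rewrite f0 /dot /= !mul0r addr0.
  rewrite d0 addr0; apply: const_comparison uS Kc KO _ _ Kx1 => x Kx nK.
  by have := hb x Kx nK; rewrite d0 addr0.
have F0 : 0 < enorm f by exact: enorm_gt0.
rewrite leNgt; apply/negP => hx1.
have [uC uJ] := uS.
have [B' B'0 hB'] := compact_enorm_bounded 0 Kc.
set B := enorm f * B'; have B0 : 0 < B by rewrite mulr_gt0.
have hB x : K x -> - B <= dot f x <= B.
  move=> /hB'; rewrite subr0 => h.
  have := dot_le_enorm f x; have := dot_le_enorm (- f) x; rewrite dotNl enormN.
  by rewrite /B => ? ?; apply/andP; split; nra.
set e := u x1 - (A + dot f x1).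
have e0 : 0 < e by rewrite subr_gt0.
pose dl := Num.min (e / (2 * B ^+ 2)) (1 / (4 * B)).
have dl0 : 0 < dl.
  by rewrite lt_min !divr_gt0 // mulr_gt0 // exprn_gt0.
have dl1 : dl * B ^+ 2 <= e / 2.
  have : dl <= e / (2 * B ^+ 2) by rewrite ge_min lexx.
  rewrite ler_pdivlMr; last by rewrite mulr_gt0 // exprn_gt0.
  lra.
have dl2 : dl * B <= 1 / 4.
  have : dl <= 1 / (4 * B) by rewrite ge_min lexx orbT.
  rewrite ler_pdivlMr; last by rewrite mulr_gt0.
  lra.
pose psi y := A + dot f y - dl * dot f y ^+ 2.
have psiC : continuous psi.
  move=> y; apply: cvgB; first apply: cvgD; first exact: cvg_cst.
    exact: dot_continuous.
  by apply: cvgMr; apply: (cvgM (@dot_continuous _ f y) (@dot_continuous _ f y)).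
have [||xh [Kxh _ hnear]] := @max_touch Om K u psi x1 (e / 2) uC Kc KO psiC Kx1.
- by have := sqr_ge0 (dot f x1); rewrite /psi /e in e0 *; nra.
- move=> x Kx nK; have := hb x Kx nK; have /andP[] := hB x Kx.
  have := sqr_ge0 (dot f x); rewrite /psi => ? ? ? ?.
  have : dot f x ^+ 2 <= B ^+ 2 by nra.
  nra.
set g := dot f xh in hnear.
have k0 : 0 < 1 - 2 * dl * g.
  by have /andP[] := hB xh Kxh; rewrite -/g; nra.
have := uJ xh ((1 - 2 * dl * g) *: f) (- 2 * dl * f.1 ^+ 2) (- 2 * dl * f.1 * f.2)
  (- 2 * dl * f.2 ^+ 2) (KO _ Kxh) _.
have -> : - 2 * dl * f.1 ^+ 2 * ((1 - 2 * dl * g) *: f).1 ^+ 2 +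
   2 * (- 2 * dl * f.1 * f.2) * ((1 - 2 * dl * g) *: f).1 * ((1 - 2 * dl * g) *: f).2 +
   - 2 * dl * f.2 ^+ 2 * ((1 - 2 * dl * g) *: f).2 ^+ 2
   = - (2 * dl * (1 - 2 * dl * g) ^+ 2 * (enorm f ^+ 2) ^+ 2).
  by rewrite enorm_sqr /dot !pair_scale1 !pair_scale2; ring.
suff hj : \forall y \near xh, u y <= u xh +
    jet ((1 - 2 * dl * g) *: f) (- 2 * dl * f.1 ^+ 2) (- 2 * dl * f.1 * f.2)
  (- 2 * dl * f.2 ^+ 2) (y - xh).
  move=> /(_ hj); rewrite leNgt => /negP; apply.
  by rewrite oppr_lt0 !mulr_gt0 // ?exprn_gt0.
apply: filterS hnear => y hy; apply: le_trans hy _.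
by rewrite lerD2l /psi -/g /jet /g /dot !pair_scale1 !pair_scale2; lra.
Qed.

End Comparison.

(** * Interior estimates *)

Section Lebesgue.
Context {R : realType}.
Implicit Types (x y z : R * R) (r h : R) (D : set (R * R)).

Definition box x h : set (R * R) :=
  `[x.1 - h, x.1 + h]%classic `*` `[x.2 - h, x.2 + h]%classic.

Notation plane := (measurableTypeR R * measurableTypeR R)%type.

Lemma measurable_box x h : measurable (box x h : set plane).
Proof. by apply: measurableX; exact: measurable_itv. Qed.

Lemma lebesgue2_box x h : 0 < h -> lebesgue2 (box x h) = ((2 * h) ^+ 2)%:E.
Proof.
move=> h0.
have -> : lebesgue2 (box x h) = (lebesgue_measure `[(x.1 - h)%R, (x.1 + h)%R]%classic *
    lebesgue_measure `[(x.2 - h)%R, (x.2 + h)%R]%classic)%E.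
  by apply: product_measure1E; exact: measurable_itv.
have len (c : R) : lebesgue_measure `[c - h, c + h]%classic = (2 * h)%:E.
  rewrite lebesgue_measure_itv /= lte_fin ifT; last by lra.
  by rewrite -EFinD; congr EFin; lra.
by rewrite !len -EFinM expr2.
Qed.

Lemma boxP x h y : box x h y <-> `|y.1 - x.1| <= h /\ `|y.2 - x.2| <= h.
Proof. by rewrite /box /= !in_itv /= !ler_distl. Qed.

Lemma measurable_eball x r : measurable (eball x r : set plane).
Proof.
have [r0|r0] := leP r 0.
  have -> : eball x r = set0; last exact: measurable0.
  by apply/seteqP; split=> // y; rewrite /eball /=; have := enorm_ge0 (y - x); lra.
have -> : eball x r = setT `&`
    ((fun y : plane => (y.1 - x.1) ^+ 2 + (y.2 - x.2) ^+ 2) @^-1` `]-oo, r ^+ 2[%classic).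
  apply/seteqP; split=> [y|y [_]]; rewrite /eball /= enorm_lt ?ltW // in_itv /= /dot /= !expr2 //.
have : measurable_fun setT (fun y : plane => (y.1 - x.1) ^+ 2 + (y.2 - x.2) ^+ 2).
  apply: measurable_funD; apply: measurable_funX; apply: measurable_funB;
    try exact: measurable_cst.
    exact: measurable_fst.
  exact: measurable_snd.
by apply => //; exact: measurable_itv.
Qed.

Lemma lebesgue2_eball x r : 0 < r ->
  exists2 v, lebesgue2 (eball x r) = v%:E & 0 < v <= 4 * r ^+ 2.
Proof.
move=> r0.
have h1 : (lebesgue2 (eball x r) <= (4 * r ^+ 2)%:E)%E.
  have -> : 4 * r ^+ 2 = (2 * r) ^+ 2 by ring.
  rewrite -(lebesgue2_box x r0); apply: le_measure; rewrite ?inE.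
  - exact: measurable_eball.
  - exact: measurable_box.
  - move=> y; rewrite /eball /= => hy; apply/boxP; split; apply: le_trans (ltW hy).
      exact: (normr1_enorm (y - x)).
    exact: (normr2_enorm (y - x)).
have r40 : 0 < r / 4 by lra.
have h2 : (((2 * (r / 4)) ^+ 2)%:E <= lebesgue2 (eball x r))%E.
  rewrite -(lebesgue2_box x r40); apply: le_measure; rewrite ?inE.
  - exact: measurable_box.
  - exact: measurable_eball.
  - move=> y /boxP[h3 h4]; rewrite /eball /=.
    by apply: le_lt_trans (enorm_le_add _) _ => /=; lra.
case: (lebesgue2 (eball x r)) h1 h2 => [v| |] //; rewrite !lee_fin => h1 h2.
exists v => //; rewrite h1 andbT; apply: lt_le_trans h2.
by rewrite exprn_gt0 //; lra.
Qed.

Import HBNNSimple.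

Lemma integral_ge_box D (f : R * R -> \bar R) x h (c : R) :
  0 < h -> 0 <= c -> box x h `<=` D -> (forall y, D y -> (0 <= f y)%E) ->
  (forall y, box x h y -> (c%:E <= f y)%E) ->
  ((c * (2 * h) ^+ 2)%:E <= \int[lebesgue2]_(y in D) f y)%E.
Proof.
move=> h0 c0 bD f0 fc; rewrite ge0_integralE //.
apply: le_ereal_sup_tmp.
pose g := indic_nnsfun R (measurable_box x h).
exists (sintegral lebesgue2 (scale_nnsfun g c0)); last first.
  rewrite (sintegralrM lebesgue2 c g) (sintegral_indic lebesgue2 (box x h)).
  by rewrite lebesgue2_box // -EFinM.
exists (scale_nnsfun g c0) => //= y.
have [yb|yb] := pselect (box x h y).
  rewrite /patch ifT; last by rewrite inE; exact: bD.
  by rewrite /mindic indicE mem_set // mulr1; exact: fc.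
rewrite /mindic indicE memNset // mulr0 /patch; case: ifPn => // /set_mem; exact: f0.
Qed.

End Lebesgue.

(** * Lipschitz and gradient bounds from the L1 norm *)

Section Interior.
Context {R : realType}.
Implicit Types (x y z : R * R) (u : R * R -> R) (Om D : set (R * R)) (r M J : R).

Lemma eball_nbhs x y r : enorm (y - x) < r -> nbhs y [set w | enorm (w - x) <= r].
Proof.
move=> h; apply/nbhs_eball; exists (r - enorm (y - x)); first by lra.
move=> w; rewrite /eball /=; have := enorm_triangle y w x; lra.
Qed.

(** Take the cone of slope 4M/r with vertex [z]: the circle of radius [r] is at distance at least
    r/2 from [z], so there the cone exceeds [u z] by 2M and dominates [u]. *)
Lemma subharmonic_lipschitz Om u x r M : subharmonic Om u -> 0 < r ->
  [set w | enorm (w - x) <= r] `<=` Om ->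
  (forall y, enorm (y - x) <= r -> `|u y| <= M) ->
  forall y z, enorm (y - x) <= r / 2 -> enorm (z - x) <= r / 2 ->
    `|u y - u z| <= 4 * M / r * enorm (y - z).
Proof.
move=> uS r0 KO hM.
suff main y z : enorm (y - x) <= r / 2 -> enorm (z - x) <= r / 2 ->
    u y - u z <= 4 * M / r * enorm (y - z).
  move=> y z hy hz; rewrite ler_norml; have := main y z hy hz; have := main z y hz hy.
  by rewrite (enormC z); lra.
move=> hy hz.
have M0 : 0 <= M by apply: le_trans (normr_ge0 _) (hM y _); lra.
have [M00|Mn0] := eqVneq M 0.
  have u0 w : enorm (w - x) <= r / 2 -> u w = 0.
    by move=> hw; apply/eqP; rewrite -normr_le0 -M00 hM //; lra.
  by rewrite !u0 // M00 mulr0 !mul0r subr0.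
have s0 : 0 < 4 * M / r by rewrite divr_gt0 // mulr_gt0 // lt_neqAle eq_sym Mn0.
rewrite lerBlDl; apply: (cone_comparison uS (cball_compact x r) KO s0 _ _); last by rewrite /=; lra.
move=> w /= hw [nw|->]; last by rewrite subrr enorm0 mulr0 addr0.
have {nw} hwr : enorm (w - x) = r.
  by apply/eqP; rewrite eq_le hw leNgt; apply/negP => /eball_nbhs.
have h1 : r / 2 <= enorm (w - z) by have := enorm_triangle z w x; lra.
have h2 : 2 * M <= 4 * M / r * enorm (w - z).
  have -> : 2 * M = 4 * M / r * (r / 2) by field; lra.
  by rewrite ler_wpM2l // ltW.
have := hM w hw; have : `|u z| <= M by apply: hM; lra.
rewrite !ler_norml; lra.
Qed.

(* The weighted maximum N = max (r/2 - |y - x|)^2 |u y| is attained at a point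
   near which |u| is comparable to its value there, by the Lipschitz bound. *)
Lemma subharmonic_mean_bound Om u x r D J : subharmonic Om u -> 0 < r ->
  eball x r `<=` Om -> eball x r `<=` D ->
  (\int[lebesgue2]_(y in D) (`|u y|)%:E <= J%:E)%E ->
  forall y, enorm (y - x) <= r / 4 -> `|u y| <= (32 * 64 * 64) * J / r ^+ 2.
Proof.
move=> uS r0 bO bD hJ.
pose g y := (r / 2 - enorm (y - x)) ^+ 2 * `|u y|.
have Kc := cball_compact x (r / 2).
have KO : [set w | enorm (w - x) <= r / 2] `<=` Om.
  by move=> w /= hw; apply: bO; rewrite /eball /=; lra.
have [||ys] := @compact_EVT_max _ R g _ _ Kc.
- by exists x; rewrite /= subrr enorm0; lra.
- move=> w; apply: cvgM.
    have h1 : (fun y => r / 2 - enorm (y - x)) @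
        nbhs (w : subspace [set w | enorm (w - x) <= r / 2]) --> r / 2 - enorm (w - x).
      apply: cvgB; first exact: cvg_cst.
      exact: (continuous_subspaceT (@enorm_continuous _ x)).
    exact: (cvgM h1 h1).
  by apply: cvg_norm; apply: (continuous_subspaceW KO uS.1).
rewrite inE /= => hys gmax.
set N := g ys in gmax.
have gN y : enorm (y - x) <= r / 2 -> g y <= N by move=> hy; apply: gmax; rewrite inE.
suff hN : N <= (2 * 64 * 64) * J.
  move=> y hy; rewrite ler_pdivlMr ?exprn_gt0 //.
  have := gN y; rewrite /g; have := normr_ge0 (u y); set t := `|u y|; set d := enorm _ in hy *.
  move=> t0 /(_ _) h; have {}h : (r / 2 - d) ^+ 2 * t <= N by apply: h; lra.
  have : (r / 4) ^+ 2 * t <= (r / 2 - d) ^+ 2 * t.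
    by apply: ler_wpM2r => //; rewrite ler_pXn2r ?nnegrE //; lra.
  nra.
have [N0|N0] := leP N 0.
  have J0 : 0 <= J.
    by rewrite -lee_fin; apply: le_trans hJ; apply: integral_ge0 => y _; rewrite lee_fin.
  lra.
(* Within [dl] of [ys] the distance to the circle of radius r/2 is at least half its value at [ys],
   so the weight drops by a factor of at most 4 and [|u|] is at most 4m. *)
pose dl := (r / 2 - enorm (ys - x)) / 2.
pose m := `|u ys|.
have NE : N = 4 * dl ^+ 2 * m by rewrite /N /g /m /dl; field.
have m0 : 0 <= m by exact: normr_ge0.
have dl0 : 0 < dl.
  rewrite lt_neqAle; apply/andP; split; last by rewrite /dl; lra.
  by apply/eqP => d0; move: N0; rewrite NE -d0 expr0n /= mulr0 mul0r ltxx.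
have bound y : enorm (y - ys) <= dl -> `|u y| <= 4 * m.
  move=> hy; have hyx : enorm (y - x) <= r / 2 - dl.
    by have := enorm_triangle ys y x; rewrite /dl in hy dl0 *; lra.
  have : g y <= N by apply: gN; lra.
  rewrite NE /g => h; have h2 : dl ^+ 2 * `|u y| <= 4 * dl ^+ 2 * m.
    apply: le_trans h; apply: ler_wpM2r => //.
    by rewrite ler_pXn2r ?nnegrE //; lra.
  have d20 : 0 < dl ^+ 2 by rewrite exprn_gt0.
  by rewrite -(ler_pM2l d20); lra.
have bO' : [set w | enorm (w - ys) <= dl] `<=` eball x r.
  move=> w /= hw; rewrite /eball /=; have := enorm_triangle ys w x; rewrite /dl in hw dl0 *; lra.
have hL := @subharmonic_lipschitz Om u ys dl (4 * m) uS dl0 (subset_trans bO' bO) bound.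
(* The box of half-side dl/64 lies within dl/32 of [ys], where the Lipschitz constant is 16m/dl;
   hence [|u|] is at least m/2 on the box. *)
have h64 : 0 < dl / 64 by lra.
have := @integral_ge_box R D (fun y => (`|u y|)%:E) ys (dl / 64) (m / 2) h64 _ _ _ _.
have hbox y : box ys (dl / 64) y -> enorm (y - ys) <= dl / 32.
  move=> /boxP[h1 h2]; apply: le_trans (enorm_le_add _) _ => /=; lra.
move=> h; have : ((m / 2 * (2 * (dl / 64)) ^+ 2)%:E <= J%:E)%E.
  apply: le_trans hJ; apply: h.
  - by lra.
  - by move=> y /hbox hy; apply: bD; apply: bO' => /=; lra.
  - by move=> y _; rewrite lee_fin.
  - move=> y /hbox hy; rewrite lee_fin.
    have := hL y ys; rewrite subrr enorm0 => /(_ _ _)/=.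
    move=> h'; have {}h' : `|u y - u ys| <= 4 * (4 * m) / dl * enorm (y - ys) by apply: h'; lra.
    have : 4 * (4 * m) / dl * enorm (y - ys) <= m / 2.
      rewrite mulrAC ler_pdivrMr //; nra.
    have := ler_normD (u ys - u y) (u y); rewrite subrK (distrC (u ys)) -/m; lra.
by rewrite lee_fin NE => ?; lra.
Qed.

Lemma subharmonic_lipschitz_mean Om u x r D J : subharmonic Om u -> 0 < r ->
  eball x r `<=` Om -> eball x r `<=` D ->
  (\int[lebesgue2]_(y in D) (`|u y|)%:E <= J%:E)%E ->
  forall y z, enorm (y - x) <= r / 8 -> enorm (z - x) <= r / 8 ->
    `|u y - u z| <= (16 * 32 * 64 * 64) * J / r ^+ 3 * enorm (y - z).
Proof.
move=> uS r0 bO bD hJ y z hy hz.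
have hb := subharmonic_mean_bound uS r0 bO bD hJ.
have r40 : 0 < r / 4 by lra.
have -> : (16 * 32 * 64 * 64) * J / r ^+ 3 = 4 * ((32 * 64 * 64) * J / r ^+ 2) / (r / 4) by field; lra.
apply: (@subharmonic_lipschitz Om u x (r / 4) _ uS r40 _ hb); try lra.
by move=> w /= hw; apply: bO; rewrite /eball /=; lra.
Qed.

(* Where the directional derivative does not exist, its value is 0. *)
Lemma derive_lipschitz u x v r M : 0 < r -> 0 <= M -> enorm v <= 1 ->
  (forall y, enorm (y - x) <= r -> `|u y - u x| <= M * enorm (y - x)) ->
  `|'D_v u x| <= M.
Proof.
move=> r0 M0 v1 hu; rewrite /derive.
set q := (fun h => _); have [cq|ncq] := pselect (cvg (q @ 0^')); last first.
  by rewrite (dvgP ncq) normr0.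
rewrite -lim_norm //; apply: limr_le; first exact: is_cvg_norm.
near=> h.
have h0 : h != 0 by near: h; exact: nbhs_dnbhs_neq.
have hr : `|h| < r.
  near: h; exact: dnbhs0_lt.
have hv : enorm (h *: v + x - x) <= `|h|.
  by rewrite addrK enormZ; have := normr_ge0 h; nra.
rewrite /q normrZ normfV mulrC ler_pdivrMr ?normr_gt0 //.
apply: le_trans (hu _ _) _; first by apply: le_trans hv (ltW hr).
by apply: ler_wpM2l.
Unshelve. all: by end_near. Qed.

(** [D] may exceed the ball: one integral over the double ball then serves every centre in the sup
    bound. *)
Lemma subharmonic_grad_bound Om u x r D J : subharmonic Om u -> 0 < r ->
  eball x r `<=` Om -> eball x r `<=` D ->
  (\int[lebesgue2]_(y in D) (`|u y|)%:E <= J%:E)%E ->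
  enorm (grad u x) <= (32 * 32 * 64 * 64) * J / r ^+ 3.
Proof.
move=> uS r0 bO bD hJ.
have hL := subharmonic_lipschitz_mean uS r0 bO bD hJ.
have J0 : 0 <= J.
  by rewrite -lee_fin; apply: le_trans hJ; apply: integral_ge0 => y _; rewrite lee_fin.
set M := (16 * 32 * 64 * 64) * J / r ^+ 3 in hL.
have M0 : 0 <= M by apply: divr_ge0; [lra|exact: exprn_ge0 (ltW r0)].
have r80 : 0 < r / 8 by lra.
have hx y : enorm (y - x) <= r / 8 -> `|u y - u x| <= M * enorm (y - x).
  by move=> hy; apply: hL => //; rewrite subrr enorm0; lra.
apply: le_trans (enorm_le_add _) _ => /=.
have -> : (32 * 32 * 64 * 64) * J / r ^+ 3 = M + M by rewrite /M; field; lra.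
apply: lerD; apply: derive_lipschitz r80 M0 _ hx;
  by rewrite enorm_le // /dot /=; lra.
Qed.

End Interior.

Section Gradient.
Context {R : realType}.
Implicit Types (x y z : R * R) (u : R * R -> R) (Om : set (R * R)) (r : R).

(** The factor 4 accounts for the bound 4 r^2 on the area of a ball. *)
Definition grad_const : R := 4 * (32 * 32 * 64 * 64).

Lemma grad_const_gt0 : 0 < grad_const.
Proof. by rewrite /grad_const; lra. Qed.

Lemma grad_le_avg Om u x r : subharmonic Om u -> 0 < r -> eball x r `<=` Om ->
  ((enorm (grad u x))%:E <= (grad_const / r)%:E * avg (eball x r) (fun y => `|u y|%R))%E.
Proof.
move=> uS r0 bO; rewrite /avg.
have [v -> /andP[v0 v4]] := lebesgue2_eball x r0.
have I0 : (0 <= \int[lebesgue2]_(y in eball x r) (`|u y|)%:E)%E.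
  by apply: integral_ge0 => y _; rewrite lee_fin.
rewrite /=.
case hJ: (\int[lebesgue2]_(y in eball x r) (`|u y|)%:E)%E I0 => [J| |] // I0; last first.
  rewrite gt0_muley ?lte_fin ?invr_gt0 // gt0_muley ?leey //.
  by rewrite lte_fin divr_gt0 // grad_const_gt0.
have hJ' : (\int[lebesgue2]_(y in eball x r) (`|u y|)%:E <= J%:E)%E by rewrite hJ.
have h := subharmonic_grad_bound uS r0 bO (@subset_refl _ _) hJ'.
rewrite lee_fin in I0; rewrite -!EFinM lee_fin; apply: le_trans h _.
have -> : 32 * 32 * 64 * 64 * J / r ^+ 3 = grad_const / r * ((4 * r ^+ 2)^-1 * J).
  by rewrite /grad_const; field; lra.
apply: ler_wpM2l; first by rewrite divr_ge0 ?ltW ?grad_const_gt0.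
by apply: ler_wpM2r => //; rewrite lef_pV2 ?posrE // mulr_gt0 // exprn_gt0.
Qed.

(** Each [y] in the ball is the centre of a ball of radius [r] inside the double ball, so the bound
    holds pointwise, hence for the essential supremum. *)
Lemma grad_Linfty_le_L1 Om u x r : subharmonic Om u -> 0 < r ->
  eball x (2 * r) `<=` Om ->
  (LnormOn +oo (eball x r) (fun y => enorm (grad u y))
     <= (grad_const / r ^+ 3)%:E * LnormOn 1 (eball x (2 * r)) u)%E.
Proof.
move=> uS r0 bO; rewrite {2}/LnormOn Lnorm1.
have -> : (\int[lebesgue2]_y `|((EFin \o u) \_ (eball x (2 * r))) y| =
    \int[lebesgue2]_(y in eball x (2 * r)) (`|u y|)%:E)%E.
  rewrite [RHS]integral_mkcond; apply: eq_integral => y _; rewrite /patch.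
  by case: ifP => //; rewrite abse0.
have I0 : (0 <= \int[lebesgue2]_(y in eball x (2 * r)) (`|u y|)%:E)%E.
  by apply: integral_ge0 => y _; rewrite lee_fin.
have c0 : 0 < grad_const / r ^+ 3.
  by rewrite divr_gt0 ?grad_const_gt0 // exprn_gt0.
case hJ: (\int[lebesgue2]_(y in eball x (2 * r)) (`|u y|)%:E)%E I0 => [J| |] // I0; last first.
  by rewrite gt0_muley ?leey // lte_fin.
rewrite lee_fin in I0.
have pos : 0 <= grad_const / r ^+ 3 * J by rewrite mulr_ge0 // ltW.
rewrite /LnormOn unlock -EFinM; case: ifP => _; last by rewrite lee_fin.
apply/ess_supP; apply: nearW => y /=; rewrite /patch; case: ifPn; last first.
  by rewrite abse0 lee_fin.
rewrite inE /= ger0_norm ?enorm_ge0 // => hy; rewrite lee_fin.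
have sub : eball y r `<=` eball x (2 * r).
  by move=> w; rewrite /eball /= in hy *; have := enorm_triangle y w x; lra.
have hJ' : (\int[lebesgue2]_(y in eball x (2 * r)) (`|u y|)%:E <= J%:E)%E by rewrite hJ.
apply: le_trans (subharmonic_grad_bound uS r0 (subset_trans sub bO) sub hJ') _.
rewrite -mulrA [leRHS]mulrAC -[leRHS]mulrA; apply: ler_wpM2r.
  by rewrite divr_ge0 // exprn_ge0 // ltW.
by rewrite /grad_const; lra.
Qed.

End Gradient.

(** * Rectilinear paths and crossing parity *)

Section Reach.
Context {R : realType}.
Implicit Types (a b p q x y z : R * R) (s : seq (R * R)) (V K : set (R * R)).

(** Used under [hv a b], when the rectangle degenerates to an axis-parallel segment. *)
Definition rect a b : set (R * R) :=
  [set p | Num.min a.1 b.1 <= p.1 <= Num.max a.1 b.1 /\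
           Num.min a.2 b.2 <= p.2 <= Num.max a.2 b.2].

Definition hv a b := a.1 = b.1 \/ a.2 = b.2.

Fixpoint chain a s : Prop := if s is b :: s' then hv a b /\ chain b s' else True.

Fixpoint trace a s : set (R * R) :=
  if s is b :: s' then rect a b `|` trace b s' else [set a].

(** Paths are finite axis-parallel polygons, so that crossings with a vertical ray can be counted
    edge by edge. *)
Definition reach V a b := exists s, [/\ chain a s, last a s = b & trace a s `<=` V].

Lemma rectC a b : rect a b = rect b a.
Proof.
by rewrite /rect (minC a.1) (minC a.2) (maxC a.1) (maxC a.2).
Qed.

Lemma rectl a b : rect a b a.
Proof. by split; rewrite ge_min le_max lexx. Qed.

Lemma rectr a b : rect a b b.
Proof. by rewrite rectC; exact: rectl. Qed.

Lemma trace_head a s : trace a s a.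
Proof. by case: s => [//|b s] /=; left; exact: rectl. Qed.

Lemma between_dist (c d t o e : R) : `|c - o| < e -> `|d - o| < e ->
  Num.min c d <= t <= Num.max c d -> `|t - o| < e.
Proof.
rewrite !ltr_norml ge_min le_max => /andP[? ?] /andP[? ?] /andP[/orP h1 /orP h2].
by apply/andP; split; [case: h1 => ?; lra|case: h2 => ?; lra].
Qed.

Lemma rect_ball a b x (e : R) :
  `|a.1 - x.1| < e -> `|a.2 - x.2| < e -> `|b.1 - x.1| < e -> `|b.2 - x.2| < e ->
  forall p, rect a b p -> `|p.1 - x.1| < e /\ `|p.2 - x.2| < e.
Proof.
by move=> a1 a2 b1 b2 p [p1 p2]; split; [exact: between_dist p1|exact: between_dist p2].
Qed.

Lemma reach_refl V a : V a -> reach V a a.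
Proof. by move=> Va; exists [::]; split => // p /= ->. Qed.

Lemma reach1 V a b : hv a b -> rect a b `<=` V -> reach V a b.
Proof.
move=> h hV; exists [:: b]; split => // p /= [/hV //|->].
by apply: hV; exact: rectr.
Qed.

Lemma reach_trans V a b c : reach V a b -> reach V b c -> reach V a c.
Proof.
move=> [s1 [c1 l1 t1]] [s2 [c2 l2 t2]]; exists (s1 ++ s2); split.
- by elim: s1 a c1 l1 {t1} => [|d s IH] a /=; [move=> _ ->|move=> [? ?] ?; split=> //; exact: IH].
- by rewrite last_cat l1.
- elim: s1 a c1 l1 t1 => [|d s IH] a /=; first by move=> _ ->.
  move=> [_ cs] ls ts p /= [hp|]; first by apply: ts; left.
  by apply: IH => // w hw; apply: ts; right.
Qed.

Lemma reach_sym V a b : reach V a b -> reach V b a.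
Proof.
move=> [s [+ + +]]; elim: s a => [|d s IH] a /=.
  by move=> _ -> aV; apply: reach_refl; exact: aV.
move=> [h cs] ls ts; apply: (@reach_trans _ _ d).
  by apply: IH => // p hp; apply: ts; right.
apply: reach1.
  by case: h => h; [left|right]; rewrite h.
by move=> p; rewrite rectC => hp; apply: ts; left.
Qed.

Lemma reach_head V a b : reach V a b -> V a.
Proof. by move=> [s [_ _]]; apply; exact: trace_head. Qed.

Lemma reach_last V a b : reach V a b -> V b.
Proof. by move/reach_sym/reach_head. Qed.

Lemma reach_near V x : nbhs x V -> exists2 e, 0 < e &
  forall y z, enorm (y - x) < e -> enorm (z - x) < e -> reach V y z.
Proof.
move=> /nbhs_boxP[e e0 he]; exists e => // y z hy hz.
have := normr1_enorm (y - x); have := normr2_enorm (y - x).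
have := normr1_enorm (z - x); have := normr2_enorm (z - x) => /= z2 z1 y2 y1.
apply: (@reach_trans _ _ (z.1, y.2)); apply: reach1; try (by right); try (by left);
  move=> p /(rect_ball (x := x) (e := e)) /= []; try lra; exact: he.
Qed.

(** Connectedness of [[a, b]] as an induction principle: local propagation carries [P] up to, and
    past, the supremum of the points where it holds. *)
Lemma segment_ind (P : R -> Prop) (a b : R) : a <= b -> P a ->
  (forall t, a <= t <= b -> exists2 d, 0 < d & forall t' t'',
     a <= t' <= b -> a <= t'' <= b -> `|t' - t| < d -> `|t'' - t| < d -> P t' -> P t'') ->
  P b.
Proof.
move=> ab Pa hP.
pose A := [set t | a <= t <= b /\ P t].
have Aa : A a by split => //; rewrite lexx ab.
have supA : has_sup A by split; [exists a|exists b => t [/andP[]]].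
have ac : a <= sup A by apply: ub_le_sup Aa; case: supA.
have cb : sup A <= b by apply: ge_sup; [exists a|move=> t [/andP[]]].
set c := sup A in ac cb.
have [|d d0 hd] := hP c; first by rewrite ac cb.
have [t [/andP[at_ tb] Pt] tc] := @sup_adherent R A d d0 supA.
have tc' : t <= c by apply: ub_le_sup; [case: supA|split => //; apply/andP].
rewrite -/c in tc.
have htc : `|t - c| < d by rewrite ltr_norml; apply/andP; split; lra.
have [cdb|bcd] := ltP (c + d / 2) b; last first.
  apply: (hd t) => //; first by rewrite at_ tb.
    by rewrite ab lexx.
  by rewrite ltr_norml; apply/andP; split; lra.
have : A (c + d / 2).
  split; first by apply/andP; split; lra.
  apply: (hd t) => //; first by rewrite at_ tb.
    by apply/andP; split; lra.
  by rewrite ltr_norml; apply/andP; split; lra.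
move=> /(ub_le_sup (proj2 supA)); rewrite -/c; lra.
Qed.

(** Nearby points of an open set are joined by two-edge paths, and [segment_ind] carries
    reachability along the segment. *)
Lemma reach_segment V x y : open V ->
  (forall t, 0 <= t <= 1 -> V (x + t *: (y - x))) -> reach V x y.
Proof.
move=> oV hV.
have := @segment_ind (fun t => reach V x (x + t *: (y - x))) 0 1 ler01.
rewrite scale0r addr0 scale1r [x + (y - x)]addrC subrK; apply.
  by apply: reach_refl; have := hV 0; rewrite scale0r addr0 lexx ler01; apply.
move=> t ht; have [e e0 he] := reach_near (open_nbhs_nbhs (conj oV (hV t ht))).
exists (e / (1 + enorm (y - x))); first by rewrite divr_gt0 // ltr_wpDr ?enorm_ge0.
have near_t t' : `|t' - t| < e / (1 + enorm (y - x)) ->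
    enorm (x + t' *: (y - x) - (x + t *: (y - x))) < e.
  have -> : x + t' *: (y - x) - (x + t *: (y - x)) = (t' - t) *: (y - x).
    by rewrite scalerBl opprD addrACA subrr add0r.
  rewrite enormZ ltr_pdivlMr; last by rewrite ltr_wpDr ?enorm_ge0.
  have := normr_ge0 (t' - t); have := enorm_ge0 (y - x); nra.
move=> t' t'' _ _ h' h'' hr; apply: reach_trans hr _.
by apply: he; exact: near_t.
Qed.

Lemma rect_compact a b : compact (rect a b).
Proof.
have -> : rect a b = `[Num.min a.1 b.1, Num.max a.1 b.1]%classic `*`
    `[Num.min a.2 b.2, Num.max a.2 b.2]%classic.
  by apply/seteqP; split=> p; rewrite /rect /= !in_itv.
by apply: compact_setX; exact: segment_compact.
Qed.

Lemma trace_compact a s : compact (trace a s).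
Proof.
elim: s a => [|b s IH] a /=; first exact: compact_set1.
by apply: compactU => //; exact: rect_compact.
Qed.

(* The parity of the number of crossings of the path with the vertical ray
   going down from q, with half-open conventions for the endpoints. *)
Definition cross q a b : bool := (a.2 < q.2) && ((a.1 <= q.1) (+) (b.1 <= q.1)).

Fixpoint parity q a s : bool :=
  if s is b :: s' then cross q a b (+) parity q b s' else false.

(** Whether the endpoint [p] is swept by the ray below [q] as its apex moves horizontally to [q'];
    false for vertical moves. *)
Definition end_defect q q' p : bool :=
  (p.2 < q.2) && ((p.1 <= q.1) (+) (p.1 <= q'.1)).

Lemma between_lt (c d t : R) : (t < c) != (t < d) -> Num.min c d <= t <= Num.max c d.
Proof.
rewrite ge_min le_max; case: (ltP t c) => h1; case: (ltP t d) => h2 //= _;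
  by rewrite ?h1 ?h2 ?(ltW h1) ?(ltW h2) ?orbT.
Qed.

Lemma between_le (c d t : R) : (c <= t) != (d <= t) -> Num.min c d <= t <= Num.max c d.
Proof.
rewrite ge_min le_max; case: (leP c t) => h1; case: (leP d t) => h2 //= _;
  by rewrite ?h1 ?h2 ?(ltW h1) ?(ltW h2) ?orbT.
Qed.

Lemma between_ge (c d t : R) : (t <= c) != (t <= d) -> Num.min c d <= t <= Num.max c d.
Proof.
rewrite ge_min le_max; case: (leP t c) => h1; case: (leP t d) => h2 //= _;
  by rewrite ?h1 ?h2 ?(ltW h1) ?(ltW h2) ?orbT.
Qed.

Lemma between_gt (c d t : R) : (c < t) != (d < t) -> Num.min c d <= t <= Num.max c d.
Proof.
rewrite ge_min le_max; case: (ltP c t) => h1; case: (ltP d t) => h2 //= _;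
  by rewrite ?h1 ?h2 ?(ltW h1) ?(ltW h2) ?orbT.
Qed.

(** If the two segments are parallel the identity is purely Boolean; if perpendicular, its failure
    makes them meet at an explicit point. *)
Lemma cross_move q q' a b : hv q q' -> hv a b ->
  (forall p, rect q q' p -> ~ rect a b p) ->
  cross q a b (+) cross q' a b = end_defect q q' a (+) end_defect q q' b.
Proof.
case: q q' a b => [q1 q2] [q1' q2'] [a1 a2] [b1 b2].
rewrite /hv /rect /cross /end_defect /=.
move=> [hq|hq] [ha|ha] disj; subst.
- by rewrite !addbb !andbF.
- have [E|nx] := eqVneq (b2 < q2) (b2 < q2').
    by rewrite E; case: (b2 < q2'); case: (a1 <= q1'); case: (b1 <= q1').
  have [E|ny] := eqVneq (a1 <= q1') (b1 <= q1').
    by rewrite E; case: (b2 < q2'); case: (b2 < q2); case: (b1 <= q1').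
  by case: (disj (q1', b2)); rewrite /= minxx maxxx lexx; split=> //;
    [exact: between_lt|exact: between_le].
- have [E|nx] := eqVneq (b1 <= q1) (b1 <= q1').
    by rewrite E; case: (b2 < q2'); case: (a2 < q2'); case: (b1 <= q1').
  have [E|ny] := eqVneq (a2 < q2') (b2 < q2').
    by rewrite E; case: (b2 < q2'); case: (b1 <= q1); case: (b1 <= q1').
  by case: (disj (b1, q2')); rewrite /= minxx maxxx lexx; split=> //;
    [exact: between_ge|exact: between_gt].
- by case: (b2 < q2') => //=; case: (a1 <= q1); case: (b1 <= q1); case: (a1 <= q1'); case: (b1 <= q1').
Qed.

(** Defects at inner vertices cancel in pairs. For two paths with common ends the sum of the
    parities is therefore locally constant off the paths. *)
Lemma parity_move q q' a s : hv q q' -> chain a s ->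
  (forall p, rect q q' p -> ~ trace a s p) ->
  parity q a s (+) parity q' a s = end_defect q q' a (+) end_defect q q' (last a s).
Proof.
move=> hq; elim: s a => [|b s IH] a /=; first by rewrite addbb.
move=> [hab cs] disj; rewrite addbACA (cross_move hq hab); last first.
  by move=> p hp hp'; apply: (disj p hp); left.
rewrite IH //; last by move=> p hp hp'; apply: (disj p hp); right.
by rewrite -addbA [_ (+) (_ (+) end_defect _ _ (last _ _))]addbA addbb addFb.
Qed.

Lemma parity_above q a s c : (forall p, trace a s p -> (p.2 < q.2) = c) ->
  parity q a s = c && ((a.1 <= q.1) (+) ((last a s).1 <= q.1)).
Proof.
elim: s a => [|b s IH] a /= h; first by rewrite addbb andbF.
rewrite IH; last by move=> p hp; apply: h; right.
rewrite /cross h; last by left; exact: rectl.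
by case: c {h IH} => //=; case: (a.1 <= q.1); case: (b.1 <= q.1); case: (_ <= q.1).
Qed.

Lemma parity_aside q a s d : (forall p, trace a s p -> (p.1 <= q.1) = d) ->
  parity q a s = false.
Proof.
elim: s a => [|b s IH] a //= h.
rewrite IH; last by move=> p hp; apply: h; right.
rewrite /cross (h a); last by left; exact: rectl.
by rewrite (h b) ?addbb ?andbF //; left; exact: rectr.
Qed.

(* Two paths with the same endpoints passing on different sides of m: the
   points off the paths where the parities differ form a bounded set around
   m whose boundary lies on the paths. *)
Lemma parity_enclose V a s1 s2 m :
  chain a s1 -> chain a s2 -> last a s1 = last a s2 ->
  trace a s1 `<=` V -> trace a s2 `<=` V ->
  parity m a s1 != parity m a s2 ->
  exists K, [/\ compact K, K m & forall x, K x -> ~ nbhs x K -> V x].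
Proof.
move=> c1 c2 l12 t1 t2 hm.
pose F := trace a s1 `|` trace a s2.
pose N q := parity q a s1 (+) parity q a s2.
have Fc : compact F by apply: compactU; exact: trace_compact.
have Fcl : closed F by apply: compact_closed => //; exact: norm_hausdorff.
have Nloc q q' : hv q q' -> (forall p, rect q q' p -> ~ F p) -> N q = N q'.
  move=> hq disj; suff : N q (+) N q' = false by case: (N q); case: (N q').
  have d1 p : rect q q' p -> ~ trace a s1 p by move=> /disj hp hp'; apply: hp; left.
  have d2 p : rect q q' p -> ~ trace a s2 p by move=> /disj hp hp'; apply: hp; right.
  by rewrite /N addbACA (parity_move hq c1 d1) (parity_move hq c2 d2) l12 addbb.
have Nnear q : ~ F q -> \forall q' \near q, ~ F q' /\ N q' = N q.
  move=> nF; have := open_nbhs_nbhs (conj (closed_openC Fcl) nF).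
  move=> /nbhs_boxP[e e0 he]; apply/nbhs_boxP; exists e => // q' h1 h2.
  split; first exact: he.
  transitivity (N (q.1, q'.2)); [apply: Nloc; first by right|symmetry; apply: Nloc; first by left].
    by move=> p /(rect_ball (x := q) (e := e)) /= [] //; rewrite ?subrr ?normr0 //; exact: he.
  by move=> p /(rect_ball (x := q) (e := e)) /= [] //; rewrite ?subrr ?normr0 //; exact: he.
have [B B0 hB] := compact_enorm_bounded 0 Fc.
have F1 p : F p -> - B < p.1 < B.
  by move=> /hB; rewrite subr0 -ltr_norml; exact: le_lt_trans (normr1_enorm p).
have F2 p : F p -> - B < p.2 < B.
  by move=> /hB; rewrite subr0 -ltr_norml; exact: le_lt_trans (normr2_enorm p).
(* Outside a square containing both paths, all of [F] lies on one side of [q], so [N q] is false;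
   this bounds the enclosed set. *)
have aside q d : (forall p, F p -> (p.1 <= q.1) = d) -> N q = false.
  by move=> h; rewrite /N !(@parity_aside _ _ _ d) // => p hp; apply: h; [right|left].
have above q c : (forall p, F p -> (p.2 < q.2) = c) -> N q = false.
  move=> h; rewrite /N !(@parity_above _ _ _ c) ?l12 ?addbb // => p hp; apply: h; [right|left] => //.
exists [set q | F q \/ N q]; split.
- apply: (@closed_bounded_compact _ _ B).
    rewrite -[X in closed X]setCK; apply: open_closedC.
    rewrite openE => q /= nq; have nF : ~ F q by move=> ?; apply: nq; left.
    apply: filterS (Nnear q nF) => q' [nF' Nq'] [//|]; rewrite Nq' => Nq.
    by apply: nq; right.
  move=> q [Fq|Nq].
    rewrite !ler_norml; have /andP[? ?] := F1 q Fq; have /andP[? ?] := F2 q Fq.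
    by split; apply/andP; split; lra.
  rewrite !ler_norml; split; apply/andP; split; rewrite leNgt; apply/negP => hq; move: Nq.
  + by rewrite (aside q false) // => p /F1 /andP[? ?]; apply/negbTE; rewrite -ltNge; lra.
  + by rewrite (aside q true) // => p /F1 /andP[? ?]; lra.
  + by rewrite (above q false) // => p /F2 /andP[? ?]; apply/negbTE; rewrite -leNgt; lra.
  + by rewrite (above q true) // => p /F2 /andP[? ?]; lra.
- by right; rewrite /N addbC; move: hm; case: (parity m a s1); case: (parity m a s2).
- move=> x hx nx; have [[/t1 //|/t2 //]|nF] := pselect (F x).
  case: hx => [//|Nx]; exfalso; apply: nx.
  by apply: filterS (Nnear x nF) => q [_ Nq]; right; rewrite Nq.
Qed.

End Reach.

(** * Disconnected superlevel sets under tilted planes *)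

Section Saddle.
Context {R : realType}.
Implicit Types (a b m f x y z : R * R) (s : seq (R * R)).

Definition above (u : R * R -> R) f (mu : R) m : set (R * R) :=
  [set x | mu + dot f (x - m) < u x].

Variables (u : R * R -> R) (L : R).
Hypothesis uL : forall x y, `|u x - u y| <= L * enorm (x - y).
Hypothesis uN : subharmonic setT (fun x => - u x).

Lemma lipschitz_continuous : continuous u.
Proof.
move=> x; apply/cvgrPdist_lt => e e0; apply/nbhs_eball.
exists (e / (1 + `|L|)); first by rewrite divr_gt0 // ltr_wpDr.
move=> y; rewrite /eball /= ltr_pdivlMr; last by rewrite ltr_wpDr.
move=> hy; apply: le_lt_trans (uL _ _) _; rewrite enormC.
have := ler_norm L; have := enorm_ge0 (y - x); nra.
Qed.

Lemma open_above f mu m : open (above u f mu m).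
Proof.
have -> : above u f mu m = (fun x => u x - dot f x) @^-1` [set t | mu - dot f m < t].
  by apply/seteqP; split=> x; rewrite /above /dot /=; lra.
apply: open_comp => [x _|]; last exact: open_gt.
by apply: cvgB; [exact: lipschitz_continuous|exact: dot_continuous].
Qed.

(** Different parities would enclose [m] in a compact set on whose boundary [u] exceeds the plane;
    comparison for [- u] then gives [mu <= u m]. *)
Lemma parity_unique a b f mu m s1 s2 : u m < mu ->
  chain a s1 -> chain a s2 -> last a s1 = b -> last a s2 = b ->
  trace a s1 `<=` above u f mu m -> trace a s2 `<=` above u f mu m ->
  parity m a s1 = parity m a s2.
Proof.
move=> um c1 c2 l1 l2 t1 t2; apply/eqP; apply: contraT => hp.
have [|K [Kc Km Kb]] := parity_enclose c1 c2 _ t1 t2 hp; first by rewrite l1.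
have := @plane_comparison R setT _ K (- f) (dot f m - mu) uN Kc (@subsetT _ K) _ m Km.
have dE x : dot f m - mu + dot (- f) x = - (mu + dot f (x - m)).
  by rewrite /dot /=; ring.
rewrite dE subrr => h.
have : - u m <= - (mu + dot f 0).
  apply: h => x Kx nx; rewrite dE lerN2 ltW //; exact: Kb.
rewrite /dot /= !mulr0; lra.
Qed.

Lemma between_signed (sg c d q : R) : sg = 1 \/ sg = -1 ->
  Num.min c d <= q <= Num.max c d -> 0 <= sg * (d - c) -> 0 <= sg * (q - c).
Proof.
move=> hsg; rewrite ge_min le_max => /andP[/orP h1 /orP h2].
by case: hsg => ->; case: h1 => ?; case: h2 => ?; lra.
Qed.

(** The path runs above the segment from [a] to [b] if [sg = 1], below it if [sg = -1]. Leaving the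
    segment in the vertical direction [sg], the plane falls at rate [L + D + 1] and [u] at rate at
    most [L]; the gain [D + 1] beats the deficit of [u] on the segment, which is at most [D]. *)
Lemma trace_around a b (w2 h c D T t sg : R) m f mu (k lam : R) :
  a.1 < b.1 -> 0 <= L -> sg = 1 \/ sg = -1 ->
  m = a + lam *: (b - a) -> 0 < lam < 1 ->
  mu - lam * k < u a -> mu + (1 - lam) * k < u b ->
  w2 = b.2 - a.2 -> h = a.2 + sg * (`|w2| + 1) ->
  D = `|u a| + L * enorm (b - a) + `|mu| + `|k| ->
  T = (L + D + 1) / (b.1 - a.1) -> t = - (sg * T) ->
  f = (k / (b.1 - a.1) - t * w2, t * (b.1 - a.1)) ->
  trace a [:: (a.1, h); (b.1, h); b] `<=` above u f mu m.
Proof.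
move=> ab L0 hsg mE /andP[l0 l1] ha hb w2E hE DE TE tE fE.
have w10 : 0 < b.1 - a.1 by rewrite subr_gt0.
have D0 : 0 <= D by rewrite DE !addr_ge0 // mulr_ge0 // enorm_ge0.
have D10 : 0 <= D + 1 by lra.
have sg2 : sg * sg = 1 by case: hsg => ->; lra.
pose base (th : R) : R * R := (a.1 + th * (b.1 - a.1), a.2 + th * w2).
have val th q : 0 <= sg * q ->
    u (base th) - (mu + (th - lam) * k) + sg * q * (D + 1) <=
    u (base th + (0, q)) - (mu + dot f (base th + (0, q) - m)).
  move=> hq.
  have -> : dot f (base th + (0, q) - m) = (th - lam) * k - sg * q * (L + D + 1).
    have TW : T * (b.1 - a.1) = L + D + 1 by rewrite TE mulfVK // gt_eqF.
    rewrite -TW fE mE /base /dot /= tE w2E /GRing.scale /=; field; lra.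
  have : `|u (base th) - u (base th + (0, q))| <= L * (sg * q).
    apply: le_trans (uL _ _) _; rewrite ler_wpM2l //.
    apply: le_trans (enorm_le_add _) _ => /=.
    have -> : a.1 + th * (b.1 - a.1) - (a.1 + th * (b.1 - a.1) + 0) = 0 by ring.
    have -> : a.2 + th * w2 - (a.2 + th * w2 + q) = - (sg * (sg * q)).
      by rewrite mulrA sg2; ring.
    rewrite normr0 add0r normrN normrM (ger0_norm hq).
    by case: hsg => ->; rewrite ?normrN normr1; lra.
  rewrite ler_norml => /andP[_ h1]; lra.
have in_above th q : 0 <= sg * q ->
    0 < u (base th) - (mu + (th - lam) * k) + sg * q * (D + 1) ->
    above u f mu m (base th + (0, q)).
  by move=> hq h0; have := val th q hq; rewrite /above /=; lra.
have sgh : sg * (h - a.2) = `|w2| + 1.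
  by rewrite hE addrAC subrr add0r mulrA sg2 mul1r.
have w2n : - `|w2| <= sg * w2 <= `|w2|.
  by rewrite -ler_norml normrM (_ : `|sg| = 1) ?mul1r //; case: hsg => ->; rewrite ?normrN normr1.
have base0 : base 0 = a by rewrite /base !mul0r !addr0 -surjective_pairing.
have base1 : base 1 = b by rewrite /base w2E !mul1r [RHS]surjective_pairing; congr pair; ring.
move=> x /= [|[|[|]]].
- rewrite /rect /= minxx maxxx => -[/le_anti x1 x2].
  have -> : x = base 0 + (0, x.2 - a.2).
    by rewrite base0 {1}[x]surjective_pairing -x1; congr pair => /=; ring.
  have hq := between_signed hsg x2; rewrite sgh in hq; have {}hq := hq (addr_ge0 (normr_ge0 _) ler01).
  apply: in_above => //; rewrite base0.
  have : 0 <= sg * (x.2 - a.2) * (D + 1) by rewrite mulr_ge0.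
  lra.
- rewrite /rect /= minxx maxxx => -[x1 /le_anti x2].
  have {}x1 : a.1 <= x.1 <= b.1 by move: x1; rewrite (min_l (ltW ab)) (max_r (ltW ab)).
  pose th := (x.1 - a.1) / (b.1 - a.1).
  have th01 : 0 <= th <= 1.
    move: x1 => /andP[x1a x1b].
    rewrite /th; apply/andP; split; first by rewrite divr_ge0 ?subr_ge0 // ltW.
    by rewrite ler_pdivrMr // mul1r lerD2r.
  have -> : x = base th + (0, h - (a.2 + th * w2)).
    rewrite [LHS]surjective_pairing -x2 /base /th; congr pair => /=; first by field; lra.
    ring.
  have hq : 1 <= sg * (h - (a.2 + th * w2)).
    have -> : sg * (h - (a.2 + th * w2)) = sg * (h - a.2) - th * (sg * w2) by ring.
    rewrite sgh; move: th01 w2n => /andP[? ?] /andP[? ?]; have := normr_ge0 w2; nra.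
  apply: in_above; first by lra.
  have h1 : D + 1 <= sg * (h - (a.2 + th * w2)) * (D + 1) by nra.
  have h2 : `|u a - u (base th)| <= L * enorm (b - a).
    apply: le_trans (uL _ _) _; rewrite ler_wpM2l //.
    have -> : a - base th = (- th) *: (b - a).
      by rewrite /base w2E; congr pair => /=; rewrite /GRing.scale /=; ring.
    rewrite enormZ normrN; have := enorm_ge0 (b - a).
    move: th01 => /andP[? ?]; rewrite ger0_norm //; nra.
  have h3 : (th - lam) * k <= `|k|.
    apply: le_trans (ler_norm _) _; rewrite normrM.
    have : `|th - lam| <= 1 by rewrite ler_norml; move: th01 => /andP[? ?]; apply/andP; split; lra.
    have := normr_ge0 k; nra.
  move: h2; rewrite ler_norml => /andP[? ?].
  have := ler_norm (- u a); have := ler_norm mu; rewrite normrN => ? ?.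
  by rewrite DE in h1 *; lra.
- rewrite rectC /rect /= minxx maxxx => -[/le_anti x1 x2].
  have -> : x = base 1 + (0, x.2 - b.2).
    by rewrite base1 {1}[x]surjective_pairing -x1; congr pair => /=; ring.
  have hh : 0 <= sg * (h - b.2).
    have -> : sg * (h - b.2) = sg * (h - a.2) - sg * w2 by rewrite w2E; ring.
    by rewrite sgh; move: w2n => /andP[? ?]; lra.
  have hq := between_signed hsg x2 hh.
  apply: in_above => //; rewrite base1.
  have : 0 <= sg * (x.2 - b.2) * (D + 1) by rewrite mulr_ge0.
  lra.
- move=> ->; have -> : b = base 1 + (0, 0) by rewrite base1 addr0.
  by apply: in_above; rewrite ?mulr0 ?mul0r ?base1; lra.
Qed.

Lemma parity_around a b h m : a.1 <= m.1 < b.1 ->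
  parity m a [:: (a.1, h); (b.1, h); b] = (h < m.2).
Proof.
move=> /andP[am mb]; rewrite /= /cross /= !addbb !andbF /= addbF.
by rewrite am leNgt mb /= andbT.
Qed.

(* Tilting the plane about the line through a and b, from steep in one vertical
   direction to steep in the other, moves the path from a to b in {u > plane}
   from one side of m to the other; hence it breaks at some slope. *)
Lemma disconnecting_slope a b m (mu k lam : R) :
  0 <= L -> a.1 < b.1 -> m = a + lam *: (b - a) -> 0 < lam < 1 ->
  u m < mu -> mu - lam * k < u a -> mu + (1 - lam) * k < u b ->
  exists f, dot f (b - a) = k /\ ~ reach (above u f mu m) a b.
Proof.
move=> L0 ab mE hlam um ha hb; apply: contrapT => hno.
have w10 : 0 < b.1 - a.1 by rewrite subr_gt0.
pose w2 := b.2 - a.2.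
(* All slopes with increment [k] over [b - a]; [t] tilts the plane about the line. *)
pose F (t : R) : R * R := (k / (b.1 - a.1) - t * w2, t * (b.1 - a.1)).
have hr t : reach (above u (F t) mu m) a b.
  apply: contrapT => nr; apply: hno; exists (F t); split => //.
  by rewrite /F /dot /= /w2; field; lra.
have hm : a.1 <= m.1 < b.1.
  move: hlam => /andP[? ?]; rewrite mE /= /GRing.scale /=; apply/andP; split; nra.
pose D := `|u a| + L * enorm (b - a) + `|mu| + `|k|.
have D0 : 0 <= D by rewrite !addr_ge0 // mulr_ge0 // enorm_ge0.
pose T := (L + D + 1) / (b.1 - a.1).
have T0 : 0 < T by rewrite divr_gt0 //; lra.
have m2 : m.2 = a.2 + lam * w2 by rewrite mE.
have w2n : - `|w2| <= lam * w2 <= `|w2|.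
  rewrite -ler_norml normrM ger0_norm; move: hlam => /andP[? ?]; last by lra.
  have := normr_ge0 w2; nra.
(* [P t]: some admissible path has the parity of a path above [m]. It holds at [- T] and propagates
   to [T], where the explicit path below [m] has the other parity. *)
pose P t := exists s, [/\ chain a s, last a s = b, trace a s `<=` above u (F t) mu m
  & parity m a s = false].
have : P T.
  apply: (@segment_ind _ P (- T) T); first by lra.
    exists [:: (a.1, a.2 + 1 * (`|w2| + 1)); (b.1, a.2 + 1 * (`|w2| + 1)); b]; split.
    - by rewrite /hv /=; do !split; [left|right|left].
    - by [].
    - apply: (@trace_around a b w2 _ 0 D T (- T) 1 m (F (- T)) mu k lam) => //.
        by left.
      by rewrite mul1r.
    - rewrite parity_around // m2; apply/negbTE; rewrite -leNgt.
      by move: w2n => /andP[? ?]; lra.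
  move=> t _; have [s [cs ls ts]] := hr t.
  have Kc : compact (trace a s) by exact: trace_compact.
  have [||ys] := @compact_EVT_min _ R (fun x => u x - dot (F t) x) _ _ Kc.
  - by exists a; exact: trace_head.
  - apply: continuous_subspaceT => x.
    by apply: cvgB; [exact: lipschitz_continuous|exact: dot_continuous].
  rewrite inE => /ts hys hmin.
  (* The clearance of the compact path over the plane: the same path stays admissible for slopes
     near [t], and [parity_unique] compares it with any other. *)
  pose eta := u ys - (mu + dot (F t) (ys - m)).
  have eta0 : 0 < eta by rewrite subr_gt0.
  have [B B0 hB] := compact_enorm_bounded m Kc.
  pose n : R * R := (- w2, b.1 - a.1).
  exists (eta / (1 + enorm n * B)).
    by rewrite divr_gt0 // ltr_wpDr // mulr_ge0 ?enorm_ge0 // ltW.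
  have near_t t' : `|t' - t| < eta / (1 + enorm n * B) -> trace a s `<=` above u (F t') mu m.
    rewrite ltr_pdivlMr; last by rewrite ltr_wpDr // mulr_ge0 ?enorm_ge0 // ltW.
    move=> htt x hx; rewrite /above /=.
    have hx1 : eta <= u x - (mu + dot (F t) (x - m)).
      have := hmin x (mem_set hx); rewrite /eta /dot /=; lra.
    have -> : dot (F t') (x - m) = dot (F t) (x - m) + (t' - t) * dot n (x - m).
      by rewrite /F /n /dot /=; ring.
    have : `|(t' - t) * dot n (x - m)| <= `|t' - t| * (enorm n * B).
      rewrite normrM ler_wpM2l // ler_norml.
      have := dot_le_enorm n (x - m); have := dot_le_enorm (- n) (x - m).
      rewrite dotNl enormN; have := hB x hx; have := enorm_ge0 n => ? ? ? ?.
      by apply/andP; split; nra.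
    rewrite ler_norml => /andP[_ h]; have := normr_ge0 (t' - t); nra.
  move=> t' t'' _ _ /near_t h' /near_t h'' [s' [cs' ls' ts' ps']].
  exists s; split => //; rewrite -ps'; exact: (parity_unique um cs cs' ls ls' h' ts').
move=> [s [cs ls ts ps]].
pose h := a.2 + -1 * (`|w2| + 1).
have : parity m a s = parity m a [:: (a.1, h); (b.1, h); b].
  apply: (parity_unique (f := F T) um cs _ ls _ ts) => //.
    by rewrite /hv /=; do !split; [left|right|left].
  apply: (@trace_around a b w2 _ 0 D T T (-1) m (F T) mu k lam) => //.
    by right.
  by rewrite mulN1r opprK.
rewrite ps parity_around // m2 => /esym/negbT; rewrite -leNgt /h.
by move: w2n => /andP[? ?]; lra.
Qed.

End Saddle.

(** * Flatness at large scales *)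

Section Flatness.
Context {R : realType}.
Implicit Types (e f x y z : R * R) (u : R * R -> R).

Lemma lipschitzN u (L : R) : (forall x y, `|u x - u y| <= L * enorm (x - y)) ->
  forall x y, `|- u x - - u y| <= L * enorm (x - y).
Proof. by move=> uL x y; rewrite -opprD normrN; exact: uL. Qed.

Section Slope.
Variables (u : R * R -> R) (L : R).
Hypothesis L0 : 0 < L.
Hypothesis uL : forall x y, `|u x - u y| <= L * enorm (x - y).
Hypothesis uS : subharmonic setT u.
Hypothesis uopt : forall c, 0 <= c < L -> exists x y, c * enorm (x - y) < u x - u y.

(** Otherwise increments from 0 stay below [c * r] on arbitrarily large circles; a cone with vertex
    [y1] and slope [c'] between [c] and [L] then dominates [u], against a pair [x1], [y1] of slope
    above [c']. *)
Lemma slope_on_circles (c : R) : 0 < c < L -> exists r0, forall r, r0 <= r ->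
  exists x, enorm x = r /\ c * r <= u x - u 0.
Proof.
move=> /andP[c0 cL]; apply: contrapT => hno.
pose c' := (c + L) / 2.
have [|x1 [y1 hxy]] := uopt (c := c').
  by apply/andP; split; rewrite /c'; lra.
(* Large enough for [(c' - c) * r] to absorb the cost [(L + c') * enorm y1] of moving the vertex
   from 0 to [y1]. *)
pose r0 := enorm x1 + enorm y1 + (L + c') * enorm y1 / (c' - c).
have cc : 0 < c' - c by rewrite /c'; lra.
have [r [r0r hr]] : exists r, r0 <= r /\ forall x, enorm x = r -> u x - u 0 < c * r.
  apply: contrapT => h; apply: hno; exists r0 => r hr; apply: contrapT => h'.
  apply: h; exists r; split => // x hx; rewrite ltNge; apply/negP => h2.
  by apply: h'; exists x.
have py : 0 <= enorm y1 by exact: enorm_ge0.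
have px : 0 <= enorm x1 by exact: enorm_ge0.
have pq : 0 <= (L + c') * enorm y1 / (c' - c).
  by apply: divr_ge0; [apply: mulr_ge0 => //; rewrite /c'; lra|exact: ltW].
have hq : (L + c') * enorm y1 <= (c' - c) * r.
  have h1 : (L + c') * enorm y1 / (c' - c) <= r by rewrite /r0 in r0r; lra.
  by rewrite [leRHS]mulrC -ler_pdivrMr.
have c'0 : 0 < c' by rewrite /c'; lra.
suff : u x1 <= u y1 + c' * enorm (x1 - y1) by lra.
apply: (cone_comparison uS (cball_compact 0 r) (@subsetT _ _) c'0); last first.
  by rewrite /= subr0; rewrite /r0 in r0r; lra.
move=> x /= hx [nx|->]; last by rewrite subrr enorm0 mulr0 addr0.
have xr : enorm x = r.
  apply/eqP; rewrite -[x in enorm x]subr0 eq_le hx leNgt; apply/negP => /eball_nbhs.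
  exact: nx.
have h1 := hr x xr.
have h2 := uL 0 y1; rewrite sub0r enormN in h2; move: h2; rewrite ler_norml => /andP[_ h2].
have h3 := enorm_triangle y1 x 0; rewrite !subr0 xr in h3.
nra.
Qed.

(** A point [xp] at a large distance [M] where [u] has grown almost at rate [L] keeps [u] above a
    downward cone with vertex there; seen from afar, that cone is nearly a plane of slope
    [(L / M) *: xp]. *)
Lemma lower_plane (eps : R) : 0 < eps -> exists r0, forall r, r0 <= r -> 0 < r ->
  exists e, enorm e = L /\ forall x, enorm x <= r -> dot e x - eps * r <= u x - u 0.
Proof.
move=> eps0.
have Lpos := L0.
have [eta eta0 etaL] : exists2 eta, 0 < eta & eta * L = eps.
  by exists (eps / L); [rewrite divr_gt0|rewrite mulfVK // gt_eqF].
have ee : 0 < eta * eps by rewrite mulr_gt0.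
have [c cL cl] : exists2 c, 0 < c < L & L - c <= eta * eps / 2.
  have q1 : L / 2 < L by lra.
  have q2 : L - eta * eps / 2 < L by lra.
  exists (Num.max (L / 2) (L - eta * eps / 2)).
    by rewrite lt_max gt_max q1 q2 divr_gt0.
  have : L - eta * eps / 2 <= Num.max (L / 2) (L - eta * eps / 2).
    by rewrite le_max lexx orbT.
  lra.
have [r0 hr0] := slope_on_circles cL.
exists (r0 * eta) => r hr r1.
have [|xp [xpr hxp]] := hr0 (r / eta); first by rewrite ler_pdivlMr.
set M := r / eta in xpr hxp.
have M0 : 0 < M by rewrite divr_gt0.
exists ((L / M) *: xp); split.
  by rewrite enormZ xpr ger0_norm ?divr_ge0 ?ltW // mulfVK // gt_eqF.
move=> x hx.
have h1 := uL x xp; rewrite ler_norml in h1; move: h1 => /andP[h1 _].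
have h2 : enorm (x - xp) <= M - dot xp x / M + enorm x ^+ 2 / (2 * M).
  have -> : M - dot xp x / M + enorm x ^+ 2 / (2 * M) =
      (enorm (x - xp) ^+ 2 + M ^+ 2) / (2 * M).
    have -> : enorm (x - xp) ^+ 2 = enorm x ^+ 2 - 2 * dot xp x + enorm xp ^+ 2.
      by rewrite !enorm_sqr /dot /=; ring.
    by rewrite xpr; field; lra.
  rewrite ler_pdivlMr; last by lra.
  have := sqr_ge0 (enorm (x - xp) - M); nra.
have -> : dot ((L / M) *: xp) x = L * (dot xp x / M).
  by rewrite /dot /= /GRing.scale /=; field; lra.
have h3 : L * (enorm x ^+ 2 / (2 * M)) <= eps * r / 2.
  have -> : eps * r / 2 = L * (r ^+ 2 / (2 * M)).
    by rewrite -etaL /M; field; rewrite !gt_eqF.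
  apply: ler_wpM2l; first exact: (ltW Lpos).
  apply: ler_wpM2r; first by rewrite invr_ge0; lra.
  by rewrite ler_pXn2r ?nnegrE ?enorm_ge0 // ltW.
have h4 : (L - c) * M <= eps * r / 2.
  have -> : eps * r / 2 = eta * eps / 2 * M by rewrite /M; field; rewrite gt_eqF.
  by rewrite ler_wpM2r // ltW.
nra.
Qed.

End Slope.

Definition flat u eps r e := forall x, enorm x <= r -> `|u x - u 0 - dot e x| <= eps * r.

Section Flat.
Variables (u : R * R -> R) (L : R).
Hypothesis L0 : 0 < L.
Hypothesis uL : forall x y, `|u x - u y| <= L * enorm (x - y).
Hypothesis uS : subharmonic setT u.
Hypothesis uN : subharmonic setT (fun x => - u x).
Hypothesis uopt : forall c, 0 <= c < L -> exists x y, c * enorm (x - y) < u x - u y.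

(** The lower planes of [u] and of [- u], with slopes [e1] and [e2], bound [u] on both sides; adding
    them shows that [e1 + e2] is small. *)
Lemma flat_large_scale (eps : R) : 0 < eps -> exists r0, forall r, r0 <= r -> 0 < r ->
  exists e, enorm e = L /\ flat u eps r e.
Proof.
move=> eps0; have e30 : 0 < eps / 3 by lra.
have uoptN c : 0 <= c < L -> exists x y, c * enorm (x - y) < - u x - - u y.
  by move=> /uopt[x [y h]]; exists y, x; rewrite enormC; lra.
have [r1 h1] := lower_plane L0 uL uS uopt e30.
have [r2 h2] := lower_plane L0 (lipschitzN uL) uN uoptN e30.
exists (Num.max r1 r2) => r; rewrite ge_max => /andP[hr1 hr2] r0.
have [e1 [e1L he1]] := h1 r hr1 r0.
have [e2 [e2L he2]] := h2 r hr2 r0.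
exists e1; split => // x hx.
pose d := e1 + e2.
have dx y : enorm y <= r -> dot d y <= 2 * (eps / 3) * r.
  move=> hy; have := he1 y hy; have := he2 y hy.
  have -> : dot d y = dot e1 y + dot e2 y by rewrite /d /dot /=; ring.
  lra.
have dd : enorm d <= 2 * (eps / 3).
  have [d0|d0] := eqVneq d 0; first by rewrite d0 enorm0; lra.
  have dn : 0 < enorm d by exact: enorm_gt0.
  have rd : 0 <= r / enorm d by rewrite divr_ge0 // ltW.
  have := dx ((r / enorm d) *: d); rewrite enormZ (ger0_norm rd).
  rewrite mulfVK ?gt_eqF // lexx => /(_ isT).
  have -> : dot d ((r / enorm d) *: d) = enorm d * r.
    have -> : dot d ((r / enorm d) *: d) = r / enorm d * enorm d ^+ 2.
      by rewrite enorm_sqr /dot /= /GRing.scale /=; ring.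
    by field; rewrite gt_eqF.
  by rewrite ler_pM2r.
have := he1 x hx; have := he2 x hx.
have : - dot d x <= enorm d * enorm x by rewrite -dotNl -(enormN d); exact: dot_le_enorm.
have -> : dot d x = dot e1 x + dot e2 x by rewrite /d /dot /=; ring.
rewrite ler_norml; have := enorm_ge0 x; have := enorm_ge0 d => ? ? ? ? ?.
by apply/andP; split; nra.
Qed.

(** The slope may vary with the scale; a cluster point on the compact circle of radius [L] serves
    arbitrarily large scales, not necessarily all. *)
Lemma flat_direction : exists e, enorm e = L /\
  forall eps r0, 0 < eps -> exists r, [/\ r0 <= r, 0 < r & flat u eps r e].
Proof.
have /choice[g hg] : forall n : nat, exists er : (R * R) * R,
    [/\ enorm er.1 = L, n%:R + 1 <= er.2 & flat u (n.+1%:R^-1) er.2 er.1].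
  move=> n; have n0 : 0 < (n.+1%:R^-1 : R) by rewrite invr_gt0 ltr0n.
  have [r0 hr0] := flat_large_scale n0.
  pose r := Num.max r0 (n%:R + 1).
  have [||e [eL he]] := hr0 r.
  - by rewrite le_max lexx.
  - by rewrite lt_max ltr_wpDl ?orbT.
  - by exists (e, r); split => //=; rewrite le_max lexx orbT.
pose S := [set e : R * R | enorm e = L].
have Sc : compact S.
  apply: (@closed_bounded_compact _ _ L).
    have -> : S = (fun e => enorm (e - 0)) @^-1` [set L].
      by apply/seteqP; split=> e; rewrite /S /= subr0.
    apply: closed_comp => [y _|]; first exact: enorm_continuous.
    exact: closed_eq.
  by move=> y <-; split; [exact: normr1_enorm|exact: normr2_enorm].
have [|e [eS ecl]] := Sc ((fun n => (g n).1) @ \oo) _.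
  by exists 0 => // n _; have [] := hg n.
exists e; split => // eps r0 eps0.
pose N := Num.truncn (2 / eps + `|r0|).
have hN : 2 / eps + `|r0| < N.+1%:R by rewrite truncnS_gt.
have hN1 : N.+1%:R^-1 <= eps / 2.
  rewrite -[leRHS]invrK lef_pV2 ?posrE ?invr_gt0 ?divr_gt0 // invf_div.
  have := normr_ge0 r0; lra.
have [||h [[n /= nN <-] ]] := ecl [set (g n).1 | n in [set n | (N <= n)%N]] (eball e (eps / 2)) _ _.
- by apply: filterS (nbhs_infty_ge N) => n hn; exists n.
- by apply/nbhs_eball; exists (eps / 2) => //; lra.
rewrite /eball /= => hen; have [_ hr hf] := hg n.
have Nn : (N.+1%:R : R) <= n%:R + 1 by rewrite -natr1 lerD2r ler_nat.
have q0 : 0 < 2 / eps by rewrite divr_gt0.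
have r0n := ler_norm r0; have r0n' := normr_ge0 r0.
exists (g n).2; split; [lra|lra|] => x hx.
have h1 := hf x hx.
have h2 : (n.+1%:R^-1 : R) <= eps / 2.
  apply: le_trans hN1; rewrite lef_pV2 ?posrE ?ltr0n // ler_nat //.
have h3 : `|dot ((g n).1 - e) x| <= enorm ((g n).1 - e) * enorm x.
  rewrite ler_norml -lerNl -dotNl dot_le_enorm andbT.
  by rewrite -(enormN ((g n).1 - e)) dot_le_enorm.
have -> : u x - u 0 - dot e x = (u x - u 0 - dot (g n).1 x) + dot ((g n).1 - e) x.
  by rewrite /dot /=; ring.
apply: le_trans (ler_normD _ _) _.
have h4 : n.+1%:R^-1 * (g n).2 <= eps / 2 * (g n).2 by rewrite ler_wpM2r //; lra.
have h5 : enorm ((g n).1 - e) * enorm x <= eps / 2 * (g n).2.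
  by apply: ler_pM; rewrite ?enorm_ge0 // ltW.
apply: le_trans (lerD (le_trans h1 h4) (le_trans h3 h5)) _; lra.
Qed.

End Flat.
End Flatness.

(** * Liouville theorem *)

Section Liouville.
Context {R : realType}.
Implicit Types (a b e f m n v w x y z : R * R).

Lemma dotBr v x y : dot v (x - y) = dot v x - dot v y.
Proof. by rewrite /dot /=; ring. Qed.

Lemma dotBl v x y : dot (x - y) v = dot x v - dot y v.
Proof. by rewrite /dot /=; ring. Qed.

Lemma dotDr v x y : dot v (x + y) = dot v x + dot v y.
Proof. by rewrite /dot /=; ring. Qed.

Lemma dotZr v (k : R) x : dot v (k *: x) = k * dot v x.
Proof. by rewrite /dot /= /GRing.scale /=; ring. Qed.

Lemma dotZl v (k : R) x : dot (k *: x) v = k * dot x v.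
Proof. by rewrite /dot /= /GRing.scale /=; ring. Qed.

Lemma dotC v w : dot v w = dot w v.
Proof. by rewrite /dot; ring. Qed.

Lemma dot_abs v w : `|dot v w| <= enorm v * enorm w.
Proof.
rewrite ler_norml dot_le_enorm andbT -lerNl -dotNl -(enormN v).
exact: dot_le_enorm.
Qed.

Lemma cross_dot v w : v.1 * w.2 - v.2 * w.1 = dot (- v.2, v.1) w.
Proof. by rewrite /dot /=; ring. Qed.

Lemma enorm_rot v : enorm (- v.2, v.1) = enorm v.
Proof. by rewrite /enorm /dot /= mulrNN addrC. Qed.

Variables (u : R * R -> R) (L : R) (e : R * R).
Hypothesis L0 : 0 < L.
Hypothesis uL : forall x y, `|u x - u y| <= L * enorm (x - y).
Hypothesis uS : subharmonic setT u.
Hypothesis uN : subharmonic setT (fun x => - u x).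
Hypothesis eL : enorm e = L.
Hypothesis e_flat : forall eps r0, 0 < eps ->
  exists r, [/\ r0 <= r, 0 < r & flat u eps r e].

Definition above_connected f := forall mu m a b,
  above u f mu m a -> above u f mu m b -> reach (above u f mu m) a b.

Lemma above_reach_segment f mu m x y :
  (forall t, 0 <= t <= 1 -> above u f mu m (x + t *: (y - x))) ->
  reach (above u f mu m) x y.
Proof. by apply: reach_segment; exact: (open_above uL). Qed.

Lemma flat_bounds eps r f mu m x : flat u eps r e -> enorm x <= r ->
  dot (e - f) x - (mu - dot f m - u 0) - eps * r <= u x - (mu + dot f (x - m))
    <= dot (e - f) x - (mu - dot f m - u 0) + eps * r.
Proof.
move=> hf hx; have := hf x hx; rewrite ler_norml dotBl dotBr.
by move=> /andP[? ?]; apply/andP; split; lra.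
Qed.

(** The half-disc is convex, so a straight segment works; its margin [2 * eps * r] absorbs the
    flatness error and the offset [c]. *)
Lemma half_disc_reach eps r f mu m x y : flat u eps r e ->
  let c := mu - dot f m - u 0 in `|c| <= eps * r ->
  enorm x <= r -> enorm y <= r ->
  2 * eps * r < dot (e - f) x -> 2 * eps * r < dot (e - f) y ->
  reach (above u f mu m) x y.
Proof.
move=> hf c hc hx hy nx ny; apply: above_reach_segment => t /andP[t0 t1].
set p := x + t *: (y - x).
have pE : p = (1 - t) *: x + t *: y by rewrite /p scalerBr scalerBl scale1r addrA addrAC.
have hp : enorm p <= r.
  rewrite pE; apply: le_trans (enormD _ _) _; rewrite !enormZ !ger0_norm //; [nra|lra].
have np : 2 * eps * r < dot (e - f) p.
  rewrite pE dotDr !dotZr; move: nx ny; set A := dot _ x; set B := dot _ y => nx ny.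
  have : 2 * eps * r < Num.min A B by rewrite lt_min nx ny.
  have : Num.min A B <= A by rewrite ge_min lexx.
  have : Num.min A B <= B by rewrite ge_min lexx orbT.
  move: (Num.min A B) => M; nra.
have /andP[h _] := flat_bounds f mu m hf hp.
by rewrite /above /=; move: hc; rewrite /c ler_norml => /andP[? ?]; lra.
Qed.

(* A component of {u > l} missing the half-disc where the flatness forces
   u > l lies in a thin strip not parallel to f. The cone of slope |f| whose
   vertex is on l, outside the strip and straight behind z in the direction f, is
   above l, agrees with l at z, and beats u on the far end of the strip. *)
Lemma reach_half_disc f : dot f (e - f) != 0 ->
  exists eps, 0 < eps /\ forall mu m z, above u f mu m z ->
  exists r0, forall r, r0 <= r -> 0 < r -> flat u eps r e ->
  exists h, [/\ enorm h <= r, 2 * eps * r < dot (e - f) h & reach (above u f mu m) z h].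
Proof.
move=> fn; set n := e - f in fn *; set ka := dot f n in fn.
have f0 : f != 0 by apply: contraNneq fn => f0; rewrite /ka f0 /dot /= !mul0r addr0.
have n0 : n != 0 by apply: contraNneq fn => nn0; rewrite /ka nn0 /dot /= !mulr0 addr0.
have F0 := enorm_gt0 f0; have N0 := enorm_gt0 n0.
set F := enorm f in F0; set N := enorm n in N0.
have K0 : 0 < `|ka| by rewrite normr_gt0.
(* Lagrange's identity turns [0 < |ka|] into [|cr| < F * N]; [gap] is, up to scaling, the resulting
   excess of the cone over the plane along the strip. *)
pose cr := f.1 * n.2 - f.2 * n.1.
have crE : cr ^+ 2 = F ^+ 2 * N ^+ 2 - `|ka| ^+ 2.
  by rewrite real_normK ?num_real // /F /N !enorm_sqr /cr /ka /dot; ring.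
have crFN : `|cr| < F * N.
  have FN0 : 0 < F * N by rewrite mulr_gt0.
  rewrite -(ltr_pXn2r (n := 2)) ?nnegrE ?normr_ge0 ?ltW //.
  rewrite real_normK ?num_real // crE exprMn.
  by have := exprn_gt0 2 K0; lra.
pose gap := N * (F * N - `|cr|) / 2.
have gap0 : 0 < gap by rewrite divr_gt0 // mulr_gt0 // subr_gt0.
have N20 : 0 < N ^+ 2 by rewrite exprn_gt0.
have den0 : 0 < 7 * `|ka| + 4 * N ^+ 2 by rewrite addr_gt0 // mulr_gt0.
have [eps [eps0 epsF epsG]] : exists eps, [/\ 0 < eps, eps * (32 * F) <= `|ka| &
    eps * (7 * `|ka| + 4 * N ^+ 2) <= gap].
  have F320 : 0 < 32 * F by rewrite mulr_gt0.
  exists (Num.min (`|ka| / (32 * F)) (gap / (7 * `|ka| + 4 * N ^+ 2))); split.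
  - by rewrite lt_min (divr_gt0 K0 F320) (divr_gt0 gap0 den0).
  - by rewrite -ler_pdivlMr // ge_min lexx.
  - by rewrite -ler_pdivlMr // ge_min lexx orbT.
exists eps; split => // mu m z hz.
pose c := mu - dot f m - u 0.
exists (`|c| / eps + `|dot n z| / eps + 4 * enorm z) => r hr r0 hf.
apply: contrapT => hno.
have p1 : 0 <= `|c| / eps by rewrite divr_ge0 // ltW.
have p2 : 0 <= `|dot n z| / eps by rewrite divr_ge0 // ltW.
have p3 := enorm_ge0 z.
have cr0 : `|c| <= eps * r by rewrite mulrC -ler_pdivrMr //; lra.
have nz0 : `|dot n z| <= eps * r by rewrite mulrC -ler_pdivrMr //; lra.
have zr : enorm z <= r / 4.
  by rewrite ler_pdivlMr // mulrC; apply: (le_trans _ hr); rewrite lerDr addr_ge0.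
have er0 : 0 < eps * r by rewrite mulr_gt0.
clear hr p1 p2 crFN crE fn.
move: cr0 nz0; rewrite !ler_norml => /andP[c1 c2] /andP[z1 z2].
set V := above u f mu m in hz hno *.
have oV : open V by exact: (open_above uL).
pose U := [set x | reach V z x].
have strip x : U x -> enorm x <= r -> - (2 * eps * r) <= dot n x <= 2 * eps * r.
  move=> Ux xr; have /andP[_ h1] := flat_bounds f mu m hf xr.
  have Vx : V x by exact: reach_last Ux.
  rewrite -/n -/c in h1; rewrite /V /above /= in Vx; apply/andP; split; first by lra.
  by rewrite leNgt; apply/negP => h2; apply: hno; exists x.
(* Going back by [tau *: f] changes [dot n] by [4 * eps * r], enough to leave the strip of
   half-width [2 * eps * r]. *)
pose tau := 4 * eps * r / `|ka|.
have tau0 : 0 < tau by rewrite divr_gt0 // -mulrA mulr_gt0.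
have tauF : tau * F <= r / 8.
  rewrite /tau mulrAC ler_pdivrMr //.
  have := ler_wpM2r (ltW r0) epsF; lra.
have tauK : tau * `|ka| = 4 * eps * r by rewrite /tau mulfVK // gt_eqF.
pose v := z - tau *: f.
have zv : enorm (z - v) = tau * F.
  by rewrite /v opprB addrC subrK enormZ ger0_norm // ltW.
have vr : enorm v <= r * 3 / 8.
  by have := enorm_triangle z v 0; rewrite !subr0 (enormC v) zv; lra.
have nv : dot n v = dot n z - tau * ka by rewrite /v dotBr dotZr (dotC n f).
have nv5 : `|dot n v| <= 5 * eps * r.
  rewrite nv; have : `|tau * ka| <= 4 * eps * r by rewrite normrM (ger0_norm (ltW tau0)) tauK.
  by rewrite !ler_norml => /andP[? ?]; apply/andP; split; lra.
have nUv : ~ U v.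
  move=> Uv; have := strip v Uv; have -> : enorm v <= r by lra.
  rewrite nv => /(_ isT) /andP[s1 s2]; move: tauK.
  have [k0|k0] := leP 0 ka; [rewrite ger0_norm //|rewrite ltr0_norm // mulrN]; lra.
pose lv := mu + dot f (v - m).
have lE x : mu + dot f (x - m) = lv + dot f (x - v) by rewrite /lv !dotBr; ring.
(* A boundary point of [K] is either off [U], where [u] is at most the plane, or in the strip on the
   circle of radius r/2 around [v]. *)
pose K := closure U `&` [set x | enorm (x - v) <= r / 2].
have Kc : compact K.
  rewrite /K setIC; apply: compact_closedI; last exact: closed_closure.
  exact: cball_compact.
have oU x : U x -> nbhs x U.
  move=> Ux; have Vx : V x by exact: reach_last Ux.
  have [d d0 hd] := reach_near (open_nbhs_nbhs (conj oV Vx)).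
  apply/nbhs_eball; exists d => // y hy; apply: reach_trans Ux _.
  by apply: hd => //; rewrite subrr enorm0.
have clU x : closure U x -> ~ U x -> u x <= lv + dot f (x - v).
  move=> cx nx; rewrite -lE leNgt; apply/negP => Vx; apply: nx.
  have [d d0 hd] := reach_near (open_nbhs_nbhs (conj oV (Vx : V x))).
  have [|y [Uy hy]] := cx (eball x d); first by apply/nbhs_eball; exists d.
  by apply: reach_trans Uy _; apply: hd => //; rewrite subrr enorm0.
have Uz : U z by exact: reach_refl.
have := @cone_comparison R setT u K v lv F uS Kc (@subsetT _ K) F0 _ z.
have Kz : K z by split; [exact: subset_closure|rewrite /= zv; lra].
move=> /(_ _ Kz) h; have {}h : u z <= lv + F * enorm (z - v).
  apply: h => x [cx /= xv] hx.
  have [Ux|nUx] := pselect (U x); last first.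
    by apply: le_trans (clU x cx nUx) _; rewrite lerD2l dot_le_enorm.
  case: hx => [nK|xv0]; last by exfalso; apply: nUv; rewrite -xv0.
  have xr : enorm (x - v) = r / 2.
    apply/eqP; rewrite eq_le xv leNgt; apply/negP => hlt; apply: nK.
    apply: filterI; last exact: eball_nbhs.
    by apply: filterS (oU x Ux); exact: subset_closure.
  have xr' : enorm x <= r.
    by have := enorm_triangle v x 0; rewrite !subr0; lra.
  have /andP[s1 s2] := strip x Ux xr'.
  have /andP[_ hu] := flat_bounds f mu m hf xr'.
  rewrite lE -/n -/c in hu.
  suff : dot f (x - v) + 4 * eps * r <= F * (r / 2) by rewrite xr; lra.
  set y := x - v.
  have ny : `|dot n y| <= 7 * eps * r.
    move: nv5; rewrite /y dotBr !ler_norml => /andP[? ?]; apply/andP; split; lra.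
  (* Decomposition of [f] along [n] and its rotation: the first part is small on the strip, the
     second is controlled by [cr]. *)
  have hcr : N ^+ 2 * dot f y = ka * dot n y - cr * (n.1 * y.2 - n.2 * y.1).
    by rewrite /N enorm_sqr /ka /cr /dot; ring.
  have hny : `|n.1 * y.2 - n.2 * y.1| <= N * (r / 2).
    have -> : n.1 * y.2 - n.2 * y.1 = dot (- n.2, n.1) y by exact: cross_dot.
    apply: le_trans (dot_abs _ _) _; rewrite -xr -/y.
    by rewrite enorm_rot.
  have t1 : ka * dot n y <= `|ka| * (7 * eps * r).
    by apply: le_trans (ler_norm _) _; rewrite normrM ler_wpM2l.
  have t2 : - (cr * (n.1 * y.2 - n.2 * y.1)) <= `|cr| * (N * (r / 2)).
    by apply: le_trans (ler_norm _) _; rewrite normrN normrM ler_wpM2l.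
  rewrite -(ler_pM2l N20) mulrDr hcr.
  have t3 := ler_wpM2r (ltW r0) epsG.
  have -> : N ^+ 2 * (F * (r / 2)) = gap * r + `|cr| * (N * (r / 2)).
    by rewrite /gap; field.
  lra.
move: hz; rewrite /V /above /= lE => hz.
have : dot f (z - v) = F * enorm (z - v).
  rewrite zv /v opprB addrC subrK dotZr mulrCA -expr2 /F enorm_sqr //.
lra.
Qed.

(** At a common flat scale both points reach the same half-disc. *)
Lemma above_connected_off_circle f : dot f (e - f) != 0 -> above_connected f.
Proof.
move=> fn mu m a b ha hb; have [eps [eps0 hreach]] := reach_half_disc fn.
have [ra hra] := hreach mu m a ha; have [rb hrb] := hreach mu m b hb.
pose c := mu - dot f m - u 0.
have [r [hr r0 hf]] := e_flat (Num.max (`|c| / eps) (Num.max ra rb)) eps0.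
move: hr; rewrite !ge_max => /and3P[hc hr1 hr2].
have [x [xr nx ax]] := hra r hr1 r0 hf.
have [y [yr ny ay]] := hrb r hr2 r0 hf.
apply: reach_trans ax _; apply: reach_trans (reach_sym ay).
apply: (half_disc_reach hf) => //.
by rewrite mulrC -ler_pdivrMr.
Qed.

(** Take a plane of increment [k] along [w], slightly above [u] at [x]. It is below [u] at [x + w]
    by assumption, and at a far point [x - tau *: w] by flatness, since [dot e w < k]. *)
Lemma disconnected_slope x w (k : R) : w.1 != 0 ->
  dot e w < k < u (x + w) - u x ->
  exists f, dot f w = k /\ ~ above_connected f.
Proof.
move=> w1 /andP[k1 k2].
pose eta := (u (x + w) - u x - k) / 2.
have eta0 : 0 < eta by rewrite /eta; lra.
have w0 : 0 < enorm w.
  by apply: enorm_gt0; apply: contraNneq w1 => ->.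
pose eps := (k - dot e w) / (8 * enorm w).
have eps0 : 0 < eps by rewrite divr_gt0 ?mulr_gt0 // subr_gt0.
pose D := u x + eta - u 0 - dot e x.
have [r [hr r0 hf]] := e_flat (2 * enorm x + `|D| / eps + 1) eps0.
have p1 : 0 <= `|D| / eps by rewrite divr_ge0 // ltW.
have p2 := enorm_ge0 x.
have Dr : D < eps * r.
  apply: le_lt_trans (ler_norm _) _; rewrite mulrC -ltr_pdivrMr //; lra.
pose tau := r / (2 * enorm w).
have tau0 : 0 < tau by rewrite divr_gt0 // mulr_gt0.
have tauw : tau * enorm w = r / 2 by rewrite /tau; field; rewrite gt_eqF.
have tauk : tau * (k - dot e w) = 4 * (eps * r).
  by rewrite /tau /eps; field; rewrite gt_eqF.
pose a := x - tau *: w; pose b := x + w.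
have ar : enorm a <= r.
  have := enorm_triangle x a 0; rewrite !subr0 /a addrAC subrr sub0r enormN enormZ.
  by rewrite (ger0_norm (ltW tau0)) tauw; lra.
have ha : u x + eta - tau * k < u a.
  have aE : dot e a = dot e x - tau * dot e w by rewrite /a dotBr dotZr.
  have := hf a ar; rewrite aE ler_norml => /andP[h _].
  have tk : tau * k - tau * dot e w = 4 * (eps * r) by rewrite -mulrBr.
  have er0 : 0 < eps * r by rewrite mulr_gt0.
  rewrite /D in Dr; lra.
have hb : u x + eta + k < u b by rewrite /b /eta; lra.
have t1 : 0 < 1 + tau by lra.
have t1n : 1 + tau != 0 by rewrite gt_eqF.
have conn f : dot f w = k -> above_connected f ->
    reach (above u f (u x + eta) x) a b.
  have ax : a - x = (- tau) *: w by rewrite /a addrAC subrr sub0r scaleNr.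
  have bx : b - x = w by rewrite /b addrAC subrr add0r.
  move=> fk; apply.
    by change (u x + eta + dot f (a - x) < u a); rewrite ax dotZr fk; lra.
  by change (u x + eta + dot f (b - x) < u b); rewrite bx fk.
have um : u x < u x + eta by lra.
apply: contrapT => hno.
have conn' f : dot f w = k -> reach (above u f (u x + eta) x) a b.
  move=> fk; apply: conn => //; apply: contrapT => nc; apply: hno; by exists f.
have L0' : 0 <= L by exact: (ltW L0).
have ba : b - a = (1 + tau) *: w.
  by rewrite /a /b opprB [LHS]addrC subrKA [LHS]addrC scalerDl scale1r.
have [w1p|w1n|w1z] := ltrgt0P w.1; last by rewrite w1z eqxx in w1.
- have := @disconnecting_slope R u L uL uN a b x (u x + eta)
    ((1 + tau) * k) (tau / (1 + tau)) L0' _ _ _ um _ _.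
  have -> : u x + eta - tau / (1 + tau) * ((1 + tau) * k) = u x + eta - tau * k by field.
  have -> : u x + eta + (1 - tau / (1 + tau)) * ((1 + tau) * k) = u x + eta + k by field.
  case=> //.
  + by rewrite /a /b /= /GRing.scale /=; nra.
  + by rewrite ba scalerA mulfVK // /a subrK.
  + by rewrite divr_gt0 //= ltr_pdivrMr // mul1r; lra.
  move=> f [fk]; apply; apply: conn'; apply: (mulfI t1n).
  by rewrite -fk ba dotZr.
- have ab : a - b = (- (1 + tau)) *: w by rewrite -opprB ba scaleNr.
  have := @disconnecting_slope R u L uL uN b a x (u x + eta)
    (- (1 + tau) * k) (1 / (1 + tau)) L0' _ _ _ um _ _.
  have -> : u x + eta - 1 / (1 + tau) * (- (1 + tau) * k) = u x + eta + k by field.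
  have -> : u x + eta + (1 - 1 / (1 + tau)) * (- (1 + tau) * k) = u x + eta - tau * k by field.
  case=> //.
  + by rewrite /a /b /= /GRing.scale /=; nra.
  + by rewrite ab scalerA mulrN mulfVK // /b scaleN1r addrK.
  + by rewrite divr_gt0 //= ltr_pdivrMr // mul1r; lra.
  move=> f [fk]; apply; apply: reach_sym; apply: conn'; apply: (mulfI t1n).
  by apply: oppr_inj; rewrite -!mulNr -fk ab dotZr.
Qed.

(* The gradient of u lies in the disc of diameter [0, e], whose support
   function is the right-hand side. *)
Lemma increment_bound x w : u (x + w) - u x <= (dot e w + L * enorm w) / 2.
Proof.
have main y : y.1 != 0 -> u (x + y) - u x <= (dot e y + L * enorm y) / 2.
  move=> y1; rewrite leNgt; apply/negP => hlt.
  set S := (dot e y + L * enorm y) / 2 in hlt.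
  have eS : dot e y <= S by rewrite /S; have := dot_le_enorm e y; rewrite eL; lra.
  pose k := (S + (u (x + y) - u x)) / 2.
  have Sk : S < k by rewrite /k; lra.
  have [|f [fk]] := @disconnected_slope x y k y1.
    by rewrite /k; apply/andP; split; lra.
  apply; apply: above_connected_off_circle; apply/eqP => f0.
  (* The circle [dot f (e - f) = 0] has centre e/2 and radius L/2, so on it [dot f y <= S], against
     [S < k]. *)
  have h : enorm (2 *: f - e) = L.
    rewrite -eL; apply/eqP; rewrite -(@eqrXn2 _ 2) ?enorm_ge0 // !enorm_sqr; apply/eqP.
    have -> : dot (2 *: f - e) (2 *: f - e) = dot e e - 4 * dot f (e - f).
      by rewrite !dotBl !dotBr !dotZl !dotZr (dotC e f); ring.
    by rewrite f0; ring.
  have := dot_le_enorm (2 *: f - e) y.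
  by rewrite h dotBl dotZl fk; rewrite /S in Sk; lra.
(* A vertical [w] is perturbed by [(t, 0)], at a cost below [d] by the Lipschitz bound. *)
have [w1|w1] := eqVneq w.1 0; last exact: main.
apply/ler_addgt0Pr => d d0.
pose t := d / (4 * L); have L0' := L0.
have t0 : 0 < t by rewrite divr_gt0 // mulr_gt0.
have tL : L * t = d / 4 by rewrite /t; field; rewrite gt_eqF.
have := main (w + (t, 0)); rewrite /= w1 add0r gt_eqF // => /(_ isT) h.
have h1 := uL (x + w) (x + (w + (t, 0))).
have ent : enorm ((t, 0) : R * R) = t.
  by rewrite /enorm /dot /= mulr0 addr0 -expr2 sqrtr_sqr ger0_norm // ltW.
move: h1; have -> : x + w - (x + (w + (t, 0))) = - (t, 0).
  by rewrite addrA opprD addrA subrr add0r.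
rewrite enormN ent tL ler_norml => /andP[_ h1].
have h2 := enormD w (t, 0); rewrite ent in h2.
have h3 := dot_le_enorm e (t, 0); rewrite ent eL tL in h3.
rewrite dotDr in h; have h4 : L * enorm (w + (t, 0)) <= L * enorm w + d / 4.
  by rewrite -tL -mulrDr ler_wpM2l // ltW.
lra.
Qed.

(* On the boundary circle of that disc, u - f . x is monotone in the
   direction of the inner normal e - 2f. *)
Lemma above_connected_on_circle f : dot f (e - f) = 0 -> f != e -> above_connected f.
Proof.
move=> f0 fe mu m a b ha hb; pose v := e - 2 *: f.
have fE : dot f e = dot f f by move: f0; rewrite dotBr; lra.
have L0' := L0.
have vL : enorm v = L.
  rewrite -eL; apply/eqP; rewrite -(@eqrXn2 _ 2) ?enorm_ge0 // !enorm_sqr; apply/eqP.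
  by rewrite /v !dotBl !dotBr !dotZl !dotZr (dotC e f) fE; ring.
set V := above u f mu m in ha hb *.
(* By [increment_bound] for the backward step, [u] changes by at least [- t * dot f e], which is
   exactly the change of the plane. *)
have up x t : 0 <= t -> V x -> V (x + t *: v).
  move=> t0; rewrite /V /above /=.
  have := increment_bound (x + t *: v) (- (t *: v)); rewrite addrK enormN enormZ vL.
  rewrite (ger0_norm t0) -scaleNr dotZr.
  have -> : dot e v = L ^+ 2 - 2 * dot f e.
    by rewrite /v dotBr dotZr -eL enorm_sqr (dotC e f).
  have -> : dot f (x + t *: v - m) = dot f (x - m) + t * dot f v.
    by rewrite dotBr dotDr dotZr [dot f (x - m)]dotBr; ring.
  have -> : dot f v = - dot f e by rewrite /v dotBr dotZr fE; ring.
  lra.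
have ray x t : 0 <= t -> V x -> reach V x (x + t *: v).
  move=> t0 Vx; apply: above_reach_segment => s /andP[s0 s1].
  by rewrite addrAC subrr add0r scalerA; apply: up => //; rewrite mulr_ge0.
have n0 : e - f != 0 by rewrite subr_eq0 eq_sym.
have N0 := enorm_gt0 n0; set N := enorm (e - f) in N0.
have nv : dot (e - f) v = N ^+ 2.
  by rewrite /N enorm_sqr /v !dotBl !dotBr !dotZr (dotC e f) fE; ring.
have [eps epsE] : exists eps, eps = N ^+ 2 / (16 * L) by eexists.
have N20 : 0 < N ^+ 2 by rewrite exprn_gt0.
have eps0 : 0 < eps by rewrite epsE divr_gt0 // mulr_gt0.
pose c := mu - dot f m - u 0.
have [B BE] : exists B, B = enorm a + enorm b by eexists.
have B0 : 0 <= B by rewrite BE addr_ge0 ?enorm_ge0.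
have [r [hr r0 hf]] := e_flat (`|c| / eps + 2 * B + (N * B + 1) / eps) eps0.
have p1 : 0 <= `|c| / eps by rewrite divr_ge0 // ltW.
have p2 : 0 <= (N * B + 1) / eps.
  by rewrite divr_ge0 ?(ltW eps0) // addr_ge0 // mulr_ge0 // ltW.
have B20 : 0 <= 2 * B by rewrite mulr_ge0.
have cr : `|c| <= eps * r.
  by rewrite mulrC -ler_pdivrMr //; apply: (le_trans _ hr); rewrite -addrA lerDl addr_ge0.
have Nr : N * B + 1 <= eps * r.
  by rewrite [leRHS]mulrC -ler_pdivrMr //; apply: (le_trans _ hr); rewrite lerDr addr_ge0.
have Br : 2 * B <= r by apply: (le_trans _ hr); rewrite addrAC lerDr addr_ge0.
pose tau := r / (2 * L).
have tau0 : 0 <= tau by rewrite divr_ge0 ?(ltW r0) // mulr_ge0 // ltW.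
have tauL : tau * L = r / 2 by rewrite /tau; field; rewrite gt_eqF.
have tauN : tau * N ^+ 2 = 8 * (eps * r) by rewrite /tau epsE; field; rewrite gt_eqF.
have er0 : 0 < eps * r by rewrite mulr_gt0.
(* Since [dot (e - f) v > 0], a long translation along [v] brings both points into the half-disc of
   a flat scale. *)
have far x : enorm x <= B -> enorm (x + tau *: v) <= r /\
    2 * eps * r < dot (e - f) (x + tau *: v).
  move=> xB; split.
    apply: le_trans (enormD _ _) _; rewrite enormZ (ger0_norm tau0) vL tauL; lra.
  rewrite dotDr dotZr nv tauN.
  have := dot_abs (e - f) x; rewrite -/N ler_norml => /andP[h _].
  have : N * enorm x <= N * B by rewrite ler_wpM2l // ltW.
  lra.
have /far[ar an] : enorm a <= B by rewrite BE; have := enorm_ge0 b; lra.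
have /far[br bn] : enorm b <= B by rewrite BE; have := enorm_ge0 a; lra.
apply: reach_trans (ray a tau tau0 ha) _.
apply: reach_trans (reach_sym (ray b tau tau0 hb)).
exact: (half_disc_reach hf cr).
Qed.

(** [above_connected f] now holds for all [f] other than [e], while a too large increment would
    disconnect for some [f] with [dot f v > dot e v]. The opposite increment gives the reverse
    inequality. *)
Lemma increment_eq x w : w.1 != 0 -> u (x + w) - u x = dot e w.
Proof.
have main y v : v.1 != 0 -> u (y + v) - u y <= dot e v.
  move=> v1; rewrite leNgt; apply/negP => hlt.
  pose k := (dot e v + (u (y + v) - u y)) / 2.
  have [|f [fk]] := @disconnected_slope y v k v1.
    by rewrite /k; apply/andP; split; lra.
  apply; have [f0|f0] := eqVneq (dot f (e - f)) 0.
    apply: above_connected_on_circle => //; apply/eqP => fe.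
    by move: fk; rewrite fe /k; lra.
  exact: above_connected_off_circle.
move=> w1; apply/eqP; rewrite eq_le main //=.
have := main (x + w) (- w); rewrite addrK /= oppr_eq0 => /(_ w1).
by rewrite (dotC e) dotNl (dotC w); lra.
Qed.

(** A vertical displacement is the sum of two nonvertical ones. *)
Lemma affine_of_flat x : u x = u 0 + dot e x.
Proof.
have [x1|x1] := eqVneq x.1 0; last first.
  by have := increment_eq 0 x1; rewrite add0r; lra.
pose p : R * R := (1, 0).
have p1 : p.1 != 0 by exact: oner_neq0.
have q1 : (x - p).1 != 0 by rewrite /= x1 sub0r oppr_eq0 oner_neq0.
have := increment_eq 0 p1; have := increment_eq p q1.
have px : p + (x - p) = x by rewrite addrC subrK.
by rewrite px add0r dotBr; lra.
Qed.

End Liouville.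

(** * Linear growth and the best Lipschitz constant *)

Section Growth.
Context {R : realType}.
Implicit Types (x y z : R * R) (u : R * R -> R).

(** [flat_direction] needs the least Lipschitz constant, taken here as an infimum; if it is 0, [u]
    is constant. *)
Lemma lipschitz_liouville u (M : R) :
  (forall x y, `|u x - u y| <= M * enorm (x - y)) ->
  subharmonic setT u -> subharmonic setT (fun x => - u x) ->
  exists a, forall x, u x = u 0 + dot a x.
Proof.
move=> uM uS uN.
pose S := [set c : R | 0 <= c /\ forall x y, u x - u y <= c * enorm (x - y)].
have SM : S `|M|.
  split => // x y; apply: le_trans (ler_norm _) _; apply: le_trans (uM x y) _.
  by apply: ler_wpM2r; [exact: enorm_ge0|exact: ler_norm].
have Sinf : has_inf S by split; [by exists (`|M|)|exists 0 => c []].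
pose L := inf S.
have L0 : 0 <= L by apply: lb_le_inf; [by exists (`|M|)|move=> c []].
have uL' x y : u x - u y <= L * enorm (x - y).
  have [xy0|xy0] := eqVneq (enorm (x - y)) 0.
    by have := SM.2 x y; rewrite xy0 !mulr0.
  have xyp : 0 < enorm (x - y) by rewrite lt_neqAle eq_sym xy0 enorm_ge0.
  rewrite -ler_pdivrMr //; apply: lb_le_inf; first by exists `|M|.
  by move=> c [_ hc]; rewrite ler_pdivrMr.
have uL x y : `|u x - u y| <= L * enorm (x - y).
  rewrite ler_norml uL' andbT lerNl opprB enormC; exact: uL'.
have [L00|Ln0] := eqVneq L 0.
  exists 0 => x; have := uL x 0; rewrite L00 mul0r normr_le0 subr_eq0 => /eqP ->.
  by rewrite /dot /= !mul0r !addr0.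
have Lp : 0 < L by rewrite lt_neqAle eq_sym Ln0.
have uopt c : 0 <= c < L -> exists x y, c * enorm (x - y) < u x - u y.
  move=> /andP[c0 cL]; apply: contrapT => hno.
  suff : L <= c by rewrite leNgt cL.
  apply: ge_inf; first by case: Sinf.
  split => // x y; rewrite leNgt; apply/negP => h; apply: hno; by exists x, y.
have [e [eL ef]] := flat_direction Lp uL uS uN uopt.
by exists e => x; exact: (affine_of_flat Lp uL uS uN eL ef).
Qed.

Lemma subharmonicB_cst Om u (c : R) : subharmonic Om u -> subharmonic Om (fun x => u x - c).
Proof.
move=> [uC uJ]; split; first by move=> x; apply: cvgB; [exact: uC|exact: cvg_cst].
move=> x p a1 a2 a3 Ox h; apply: (uJ x p a1 a2 a3 Ox).
by apply: filterS h => y; lra.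
Qed.

Lemma avg_integral_le (f : R * R -> R) x (r La : R) : 0 < r -> (forall y, 0 <= f y) ->
  ((r^-1)%:E * avg (eball x r) f < La%:E)%E ->
  (\int[lebesgue2]_(y in eball x r) (f y)%:E <= (4 * La * r ^+ 3)%:E)%E.
Proof.
move=> r0 f0; rewrite /avg; have [v -> /andP[v0 v4]] := lebesgue2_eball x r0.
have I0 : (0 <= \int[lebesgue2]_(y in eball x r) (f y)%:E)%E.
  by apply: integral_ge0 => y _; rewrite lee_fin.
rewrite /=; case hJ: (\int[lebesgue2]_(y in eball x r) (f y)%:E)%E I0 => [J| |] // I0; last first.
  by rewrite gt0_muley ?lte_fin ?invr_gt0 // gt0_muley ?lte_fin ?invr_gt0.
rewrite lee_fin in I0; rewrite -!EFinM lte_fin lee_fin mulrA -invfM.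
rewrite mulrC ltr_pdivrMr ?mulr_gt0 // => h.
have La0 : 0 < La by rewrite -(pmulr_lgt0 _ (mulr_gt0 r0 v0)) (le_lt_trans I0 h).
have -> : 4 * La * r ^+ 3 = La * (r * (4 * r ^+ 2)) by ring.
by apply: le_trans (ltW h) _; rewrite ler_pM2l // ler_pM2l.
Qed.

(** Arbitrarily large [r] admit a [c] for which [|u - c|] has mean below [La * r]; the Lipschitz
    bound for [u - c] on the ball of radius [r / 8] is then independent of [r] and [c]. *)
Lemma linear_growth_lipschitz u : subharmonic setT u ->
  (limf_einf (fun r : R => ereal_inf [set (r^-1)%:E * avg (eball 0%R r) (fun x => `|u x - c|%R)
     | c in [set: R]]) (pinfty_nbhs R) < +oo)%E ->
  exists M, forall x y, `|u x - u y| <= M * enorm (x - y).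
Proof.
move=> uS; set g := (fun r : R => _); rewrite /limf_einf /limf_esup.
set X := ereal_inf _ => hX.
(* The lower limit of [g] is [- X], so a real [La] above it satisfies [- La < X]. *)
have [La hLa] : exists La : R, ((- La)%:E < X)%E.
  case: X hX => [t _|_|//]; last by exists 0; rewrite ltry.
  by exists (1 - t); rewrite lte_fin; lra.
exists (4 * (16 * 32 * 64 * 64) * La) => y z.
pose r0 := 1 + 8 * enorm y + 8 * enorm z.
pose V := [set r : R | r0 < r].
have : (X <= ereal_sup [set (- g r)%E | r in V])%E.
  by apply: ereal_inf_lbound; exists V => //; apply: nbhs_pinfty_gt; exact: num_real.
move=> /(lt_le_trans hLa) /ereal_sup_gt[_ [r /= hr <-]].
rewrite EFinN lteN2 => /ereal_inf_lt[_ [c _ <-] hc].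
have py := enorm_ge0 y; have pz := enorm_ge0 z; rewrite /V /r0 /= in hr.
have rp : 0 < r by lra.
have hJ := avg_integral_le rp (fun y => normr_ge0 _) hc.
have := @subharmonic_lipschitz_mean R setT _ 0 r (eball 0 r) (4 * La * r ^+ 3)
  (subharmonicB_cst c uS) rp (@subsetT _ _) (@subset_refl _ _) hJ y z.
rewrite !subr0 => h; clear hX hLa hc hJ X.
have -> : 4 * (16 * 32 * 64 * 64) * La = 16 * 32 * 64 * 64 * (4 * La * r ^+ 3) / r ^+ 3.
  by field; rewrite gt_eqF.
have -> : u y - u z = u y - c - (u z - c) by ring.
by apply: h; lra.
Qed.

End Growth.

Theorem theorem1p1 (R : realType) :
  exists C : R, 0 < C /\
  (* (i) *)
  (forall (Omega : set (R * R)) (u : R * R -> R),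
    domain Omega -> inf_harmonic Omega u ->
    (forall (x : R * R) (r : R), 0 < r -> eball x r `<=` Omega ->
      ((enorm (grad u x))%:E
        <= (C / r)%:E * avg (eball x r) (fun y => `|u y|%R))%E) /\
    (forall (x : R * R) (r : R), 0 < r -> eball x (2 * r) `<=` Omega ->
      (LnormOn +oo (eball x r) (fun y => enorm (grad u y))
        <= (C / r ^+ 3)%:E * LnormOn 1 (eball x (2 * r)%R) u)%E)) /\
  (* (ii) *)
  (forall u : R * R -> R,
    inf_harmonic [set: R * R] u ->
    (limf_einf
       (fun r : R =>
          ereal_inf [set (r^-1)%:E * avg (eball 0%R r) (fun x => `|u x - c|%R)
                    | c in [set: R]])
       (pinfty_nbhs R) < +oo)%E ->
    exists a : R * R, forall x : R * R, u x = u 0 + dot a x).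
Proof.
exists grad_const; split; first exact: grad_const_gt0.
split=> [D u _ /inf_harmonic_sub uS|u uH growth].
  by split=> x r r0 bO; [exact: (grad_le_avg uS r0 bO)|exact: (grad_Linfty_le_L1 uS r0 bO)].
have uS := inf_harmonic_sub uH.
have [M uM] := linear_growth_lipschitz uS growth.
exact: (lipschitz_liouville uM uS (inf_harmonic_subN uH)).
Qed.
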